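(* The popular matching problem with strictly ordered preference lists is in NC: there is an NC algorithm (polylogarithmic parallel time with polynomially many processors) that, given an instance, either outputs a popular matching or correctly determines that the instance admits no popular matching.
   Context: An instance of the popular matching problem consists of a set $\mathcal{A}$ of applicants, a set $\mathcal{P}$ of posts, and for each applicant $a$ a preference list ranking a non-empty subset of $\mathcal{P}$; here the lists are strictly ordered (no ties). Equivalently it is a bipartite graph $G=(\mathcal{A}\cup\mathcal{P},E)$ with $(a,p)\in E$ iff $p$ is on $a$'s list, the edge having rank $i$ if $p$ is in position $i$ on $a$'s list. A matching is a set of edges no two sharing an endpoint; $M(a)$ denotes the post matched to $a$. An applicant $a$ prefers matching $M'$ to $M$ if either $a$ is matched in $M'$ and unmatched in $M$, or $a$ is matched in both and prefers $M'(a)$ to $M(a)$. Let $P(M,M')$ be the set of applicants preferring $M$ to $M'$. $M'$ is more popular than $M$ if $|P(M',M)|>|P(M,M')|$. A matching $M$ is popular if no matching is more popular than $M$. *)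

(* Defs.v *)
From mathcomp Require Import all_boot.

Set Implicit Arguments.
Unset Strict Implicit.
Unset Printing Implicit Defensive.

(** * Parallel random access machine

    A synchronous PRAM in the style of Fortune and Wyllie.  One program,
    independent of the input, is executed by all processors in lock step; each
    processor has its own program counter and its own registers, and all share
    one memory of natural numbers.  There is no multiplication: a step at most
    doubles the largest value held by the machine, so the unit-cost measure is
    legitimate (in polylogarithmic time, from inputs of polynomial magnitude,
    all values keep polylogarithmic bit length). *)

Inductive instr : Type :=
| Const of nat & nat          (* Const r c  : r := c *)
| Add of nat & nat & nat      (* Add r a b  : r := a + b *)
| Sub of nat & nat & nat      (* Sub r a b  : r := a - b, truncated at 0 *)
| Half of nat & nat           (* Half r a   : r := floor (a / 2) *)
| Read of nat & nat           (* Read r a   : r := shared[a] *)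
| Write of nat & nat          (* Write a b  : shared[a] := b *)
| JumpZ of nat & nat          (* JumpZ r l  : if r = 0, continue at line l *)
| Halt.

Definition program := seq instr.

Record proc := Proc { pc : nat; reg : nat -> nat }.

Record config := Config { procs : seq proc; shared : nat -> nat }.

Definition update (f : nat -> nat) (x v : nat) : nat -> nat :=
  fun y => if y == x then v else f y.

(* Running past the end of the program halts. *)
Definition fetch (pr : program) (s : proc) : instr := nth Halt pr (pc s).

Definition proc_step (pr : program) (m : nat -> nat) (s : proc) : proc :=
  let g := reg s in
  let set r v := Proc (pc s).+1 (update g r v) in
  match fetch pr s with
  | Const r c => set r c
  | Add r a b => set r (g a + g b)
  | Sub r a b => set r (g a - g b)
  | Half r a => set r (g a)./2
  | Read r a => set r (m (g a))
  | Write _ _ => Proc (pc s).+1 g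
  | JumpZ r l => Proc (if g r == 0 then l else (pc s).+1) g
  | Halt => s
  end.

Definition proc_write (pr : program) (s : proc) : option (nat * nat) :=
  if fetch pr s is Write a b then Some (reg s a, reg s b) else None.

(* All reads of a step see the memory as it was before the step.  Concurrent
   writes to a cell are resolved in favour of the processor of least index
   (priority CRCW); NC does not depend on the conflict rule. *)
Definition step (pr : program) (c : config) : config :=
  let writes := pmap (proc_write pr) (procs c) in
  Config [seq proc_step pr (shared c) s | s <- procs c]
         (fun x => head (shared c x) [seq w.2 | w <- writes & w.1 == x]).

Definition run (pr : program) (t : nat) (c : config) : config :=
  iter t (step pr) c.

Definition proc_halted (pr : program) (s : proc) : bool :=
  if fetch pr s is Halt then true else false.

Definition halted (pr : program) (c : config) : bool :=
  all (proc_halted pr) (procs c).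

(* Register 0 of processor number i initially holds i; every other register,
   and every memory cell beyond the input, holds 0. *)
Definition init (p : nat) (input : seq nat) : config :=
  Config [seq Proc 0 (update (fun=> 0) 0 i) | i <- iota 0 p] (nth 0 input).

(** The search problem given by [correct] (the relation between an instance and
    the final memory) is in NC: a single program solves every instance of size
    n with n ^ d + d processors in at most c * (log n) ^ k + c steps. *)
Definition solvable_in_NC (I : Type) (size_of : I -> nat)
    (encode : I -> seq nat) (correct : I -> (nat -> nat) -> Prop) : Prop :=
  exists (pr : program) (d c k : nat), forall x : I,
    exists t : nat,
      [/\ t <= c * trunc_log 2 (size_of x) ^ k + c,
          halted pr (run pr t (init (size_of x ^ d + d) (encode x))) &
          correct x (shared (run pr t (init (size_of x ^ d + d) (encode x))))].

(** * Popular matchings *)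

(* [pref a] lists the acceptable posts of [a] from most to least preferred;
   duplicate-freeness makes it a strict ranking. *)
Record instance := Instance {
  napp : nat;
  npost : nat;
  pref : 'I_napp -> seq 'I_npost;
  pref_uniq : forall a, uniq (pref a);
  pref_nonempty : forall a, pref a != [::]
}.

Section Matchings.

Variable G : instance.

Notation edge := ('I_(napp G) * 'I_(npost G))%type.

Definition edges : {set edge} := [set e : edge | e.2 \in pref e.1].

Definition rank (a : 'I_(napp G)) (p : 'I_(npost G)) : nat :=
  (index p (pref a)).+1.

Definition is_matching (M : {set edge}) : Prop :=
  M \subset edges /\
  forall e e', e \in M -> e' \in M -> e.1 = e'.1 \/ e.2 = e'.2 -> e = e'.

Definition matched_post (M : {set edge}) (a : 'I_(napp G)) :
  option 'I_(npost G) := [pick p | (a, p) \in M].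

Definition prefers (a : 'I_(napp G)) (M' M : {set edge}) : bool :=
  match matched_post M' a, matched_post M a with
  | Some _, None => true
  | Some p', Some p => rank a p' < rank a p
  | None, _ => false
  end.

Definition preferring (M M' : {set edge}) : {set 'I_(napp G)} :=
  [set a | prefers a M M'].

Definition more_popular (M' M : {set edge}) : Prop :=
  #|preferring M' M| > #|preferring M M'|.

Definition popular (M : {set edge}) : Prop :=
  is_matching M /\ ~ exists M', is_matching M' /\ more_popular M' M.

(** * Input and output conventions *)

(* Number of vertices of the bipartite graph; it is polynomially related to the
   number of vertices and edges. *)
Definition instance_size : nat := napp G + npost G.

(* The two cardinalities, followed by the matrix of edge ranks in row-major
   order (one row per applicant), where 0 marks a non-edge. *)
Definition encode_instance : seq nat :=
  napp G :: npost G ::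
  [seq if (a, p) \in edges then rank a p else 0
     | a <- enum 'I_(napp G), p <- enum 'I_(npost G)].

(* Cell 0 tells whether a popular matching exists; if so, cell a + 1 holds
   M(a) + 1, or 0 when applicant a is unmatched. *)
Definition solves_popular_matching (out : nat -> nat) : Prop :=
  (out 0 = 1 /\
   exists M, popular M /\
     forall a : 'I_(napp G),
       out a.+1 = if matched_post M a is Some p then p.+1 else 0) \/
  (out 0 = 0 /\ ~ exists M, popular M).

End Matchings.

(* Main.v *)
(**
  Write f(a) for the first post of an applicant a, and s(a) for its first post
  that is nobody's first (a private last resort if there is none).  A matching
  is popular if every applicant gets f(a) or s(a) and every f-post is held by
  somebody who ranks it first, and every popular matching is of this form.
  Choosing between f(a) and s(a) so that no post is used twice is a 2-SAT
  instance with one variable per applicant.  Its implication graph is closed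
  transitively by repeated squaring; the instance is unsatisfiable iff some
  literal and its negation reach each other.  Otherwise discard the literals
  reachable from their own negation, and compare the least remaining literals
  reachable from u and from its negation: they differ, and calling u true when
  its own is the later one respects all implications.  Finally each f-post left
  free is given to an arbitrary applicant who ranks it first.

  All this takes a constant number of parallel writes besides the log-many
  squarings.  The program is written in a small language in which all
  processors stay in lock step, loops being controlled by values common to
  all of them.
*)

(* Asking 2-SAT only for distinct posts may leave f-posts that nobody holds. Conversely a popular
   matching satisfies every implication, so a cycle through a literal and its negation excludes one.

   Sequential 2-SAT procedures fix variables one after another. Here each literal is decided alone,
   from two maxima over the closed relation; their monotonicity along implications makes the
   separate decisions consistent.

   The machine cannot multiply or divide, while squaring needs processors indexed by triples. The
   side [W] of the grid is therefore a power of two, and each processor decodes its number by loops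
   over bits, in the same logarithmic time as the squarings. [W] is twice a power of two [N] that
   exceeds the number of vertices: the literals 2a and 2a + 1 fit below [W], and [N + a] is a fresh
   name for the last resort of applicant a. The implication graph has [W = 2 ^ L.+1] vertices, hence
   [L.+1] squarings. *)
Require Import Defs.
From mathcomp Require Import all_boot.
From mathcomp Require Import zify.

Set Implicit Arguments.
Unset Strict Implicit.
Unset Printing Implicit Defensive.

(** * Popular matchings and first and second choices *)

Section PopularMatchings.

Variable G : instance.
Notation app := 'I_(napp G).
Notation post := 'I_(npost G).
Notation edge := (app * post)%type.

(* [None] stands for the last resort post, which follows all others. *)
Definition place (a : app) (o : option post) : nat :=
  if o is Some p then index p (pref a) else size (pref a).

Lemma prefersE M M' a : is_matching M -> is_matching M' ->
  prefers a M' M = (place a (matched_post M' a) < place a (matched_post M a)).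
Proof.
move=> [/subsetP sM _] [/subsetP sM' _]; rewrite /prefers /place /rank /matched_post.
case: pickP => [p' /sM'|_]; case: pickP => [p /sM|_] //; rewrite ?inE /=.
- by rewrite index_mem.
- by rewrite -index_mem => h; rewrite ltnNge ltnW.
- by rewrite ltnn.
Qed.

Definition graph_of (mu : app -> option post) : {set edge} :=
  [set e : edge | mu e.1 == Some e.2].

Definition acceptable (mu : app -> option post) : Prop :=
  (forall a p, mu a = Some p -> p \in pref a) /\
  (forall a b p, mu a = Some p -> mu b = Some p -> a = b).

Lemma matched_post_graph_of mu a : matched_post (graph_of mu) a = mu a.
Proof.
rewrite /matched_post; case: pickP => [p|]; first by rewrite inE => /eqP.
by move=> h; case e: (mu a) => [p|] //; move: (h p); rewrite inE e eqxx.
Qed.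

Lemma graph_of_matching mu : acceptable mu -> is_matching (graph_of mu).
Proof.
move=> [h1 h2]; split; first by apply/subsetP => -[a p]; rewrite !inE => /eqP/h1.
move=> [a p] [b q]; rewrite !inE /= => /eqP ha /eqP hb [e|e].
  by move: ha; rewrite e hb => -[->].
by rewrite -e in hb *; rewrite (h2 _ _ _ ha hb).
Qed.

Lemma matched_post_acceptable M : is_matching M -> acceptable (matched_post M).
Proof.
move=> [/subsetP sM hM].
have hm a p : matched_post M a = Some p -> (a, p) \in M.
  by rewrite /matched_post; case: pickP => // p' h [<-].
split=> [a p /hm/sM|a b p /hm ha /hm hb]; first by rewrite inE.
by have [] := hM _ _ ha hb (or_intror erefl).
Qed.

Definition fpost (a : app) : option post := ohead (pref a).

Definition is_fpost (p : post) : bool := [exists a, fpost a == Some p].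

Definition spost (a : app) : option post :=
  ohead [seq p <- pref a | ~~ is_fpost p].

Lemma fpostP a : exists2 p, fpost a = Some p & p \in pref a.
Proof.
rewrite /fpost; have := pref_nonempty a; case: (pref a) => // p s _.
by exists p; rewrite ?mem_head.
Qed.

Lemma place_fpost a : place a (fpost a) = 0.
Proof.
by rewrite /fpost /place; have := pref_nonempty a; case: (pref a) => //= p s; rewrite eqxx.
Qed.

Lemma place_eq0 a o : (place a o == 0) = (o == fpost a).
Proof.
rewrite /fpost /place; have := pref_nonempty a; case: (pref a) => //= q s _.
case: o => [p|] //=; case: (eqVneq q p) => [->|h]; rewrite ?eqxx //=.
by apply/esym/eqP => -[e]; rewrite e eqxx in h.
Qed.

Lemma is_fpostP a p : fpost a = Some p -> is_fpost p.
Proof. by move=> h; apply/existsP; exists a; rewrite h. Qed.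

Lemma spostP a p : spost a = Some p -> p \in pref a /\ ~~ is_fpost p.
Proof.
rewrite /spost => h; have : p \in [seq p <- pref a | ~~ is_fpost p].
  by case: [seq _ <- _ | _] h => //= x s [->]; rewrite mem_head.
by rewrite mem_filter => /andP[].
Qed.

Lemma lt_spost_fpost a p : place a (Some p) < place a (spost a) -> is_fpost p.
Proof.
rewrite /spost /place; apply: contraTT => npf; rewrite -leqNgt.
elim: (pref a) => [|x s] //=; have [->|ne] := eqVneq x p.
  by rewrite npf /= eqxx.
case: ifP => npx /=; first by rewrite eqxx.
case e: (ohead _) => [y|] /= ih //; case: (x == y) => //.
Qed.

(** Send an applicant [a] that gains a post [p] in [M'] to the holder of [p] in [mu] who ranks it
    first. Nothing beats f(a) and only f-posts beat s(a), so this holder exists, and it loses its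
    first choice to [a]. The map is injective: [mu] recovers [p] from the holder and [M'] recovers
    [a] from [p]. *)
Lemma popular_of_fs mu : acceptable mu ->
  (forall a, mu a = fpost a \/ mu a = spost a) ->
  (forall p, is_fpost p -> exists a, mu a = Some p /\ fpost a = Some p) ->
  popular (graph_of mu).
Proof.
move=> hmu fs hf; have mM := graph_of_matching hmu; split=> // -[M' [mM' ]].
rewrite /more_popular ltnNge => /negP; apply.
have [acc' inj'] := matched_post_acceptable mM'.
pose h a := if matched_post M' a is Some p then
  odflt a [pick b | (mu b == Some p) && (fpost b == Some p)] else a.
have hP a : a \in preferring M' (graph_of mu) -> exists p,
    [/\ matched_post M' a = Some p, mu (h a) = Some p, fpost (h a) = Some p & mu a <> Some p].
  rewrite inE prefersE // matched_post_graph_of => lt.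
  have : place a (matched_post M' a) < place a (spost a).
    by case: (fs a) lt => ->; rewrite ?place_fpost.
  case e: (matched_post M' a) => [p|] lt'; last first.
    move: lt'; rewrite /place; case: (spost a) (@spostP a) => [q|]; last by rewrite ltnn.
    by move=> /(_ q erefl) [qa _]; rewrite ltnNge ltnW // index_mem.
  exists p; have /hf[b [b1 b2]] := lt_spost_fpost lt'.
  rewrite /h e; case: pickP => [c /andP[/eqP c1 /eqP c2]|/(_ b)]; last by rewrite b1 b2 eqxx.
  by split=> // e'; move: lt; rewrite e e' ltnn.
rewrite -(@card_in_imset _ _ h); last first.
  move=> a b /hP[p [p1 p2 _ _]] /hP[q [q1 q2 _ _]] e.
  by move: p2; rewrite e q2 => -[epq]; rewrite epq in q1; apply: inj' p1 q1.
apply/subset_leq_card/subsetP => _ /imsetP[a /hP[p [p1 p2 p3 p4]] ->].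
rewrite inE prefersE // matched_post_graph_of p2 -{1}p3 place_fpost lt0n.
rewrite place_eq0 p3; apply/eqP => e.
by apply: p4; rewrite (inj' _ _ _ p1 e) p2.
Qed.

(* Otherwise move [a] to [q], the holder of [q] to its first choice, and evict
   whoever holds that one: two applicants gain and at most one loses. *)
Lemma popular_holder M a q : popular M -> q \in pref a ->
  place a (Some q) < place a (matched_post M a) ->
  exists b, matched_post M b = Some q /\ fpost b = Some q.
Proof.
move=> [mM popM] qa ltq; set mu := matched_post M in ltq *.
have [acc inj] := matched_post_acceptable mM; rewrite -/mu in acc inj.
case: (pickP [pred b | (mu b == Some q) && (fpost b == Some q)]) => [b|nob].
  by case/andP => /eqP ? /eqP ?; exists b.
case: popM.
have nf b : mu b = Some q -> fpost b <> Some q.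
  by move=> e e'; move: (nob b); rewrite /= e e' eqxx.
have amu : mu a <> Some q by move=> e; move: ltq; rewrite e ltnn.
pose kicked b := [exists b1, (mu b1 == Some q) && (fpost b1 == mu b)].
pose mu' b := if b == a then Some q else if mu b == Some q then fpost b else
  if kicked b then None else mu b.
have acc' : acceptable mu'.
  split=> [b p|b c p].
    rewrite /mu'; case: eqP => [->[<-] //|_]; case: eqP => _.
      by case: (fpostP b) => p' -> ? [<-].
    by case: ifP => // _ /acc.
  rewrite /mu'; case: (eqVneq b a) => [->|nba]; case: (eqVneq c a) => [->|nca] //.
  - move=> [<-]; case: (eqVneq (mu c) (Some q)) => [/nf //|/eqP h].
    by case: ifP.
  - move=> + [e]; rewrite -e; case: (eqVneq (mu b) (Some q)) => [/nf //|/eqP h].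
    by case: ifP.
  case: (eqVneq (mu b) (Some q)) => eb; case: (eqVneq (mu c) (Some q)) => ec.
  - by move=> _ _; apply: inj eb ec.
  - move=> e1; case: ifP => // /existsP nk e2; case: nk; exists b.
    by rewrite eb e1 e2 !eqxx.
  - case: ifP => // /existsP nk e1 e2; case: nk; exists c.
    by rewrite ec e1 e2 !eqxx.
  - by do 2![case: ifP => // _]; apply: inj.
have mM' := graph_of_matching acc'.
exists (graph_of mu'); split=> //; rewrite /more_popular.
have better b : (b \in preferring (graph_of mu') M) = (place b (mu' b) < place b (mu b)).
  by rewrite inE prefersE // matched_post_graph_of.
have worse b : (b \in preferring M (graph_of mu')) = (place b (mu b) < place b (mu' b)).
  by rewrite inE prefersE // matched_post_graph_of.
have ina : a \in preferring (graph_of mu') M by rewrite better /mu' eqxx.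
(* If [q] is free nobody is evicted, and one winner against no loser is enough. *)
case: (pickP [pred b | mu b == Some q]) => [b1 /eqP eb1|nob1]; last first.
  rewrite (_ : preferring M _ = set0) ?cards0 ?card_gt0; last first.
    apply/setP => b; rewrite worse in_set0; apply/negbTE; rewrite -leqNgt /mu'.
    case: eqP => [->|_]; first exact: ltnW.
    have nk : kicked b = false.
      by apply/existsP => -[b2]; have := nob1 b2; rewrite /= => ->.
    by rewrite nk; have := nob1 b; rewrite /= => ->.
  by apply/set0Pn; exists a.
have ab1 : a != b1 by apply: contra_not_neq amu => ->.
have inb1 : b1 \in preferring (graph_of mu') M.
  rewrite better /mu' eq_sym (negPf ab1) eb1 eqxx place_fpost lt0n place_eq0.
  by rewrite eq_sym; apply/eqP/nf.
apply: (@leq_ltn_trans 1); last first.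
  have <- : #|[set a; b1]| = 2 by rewrite cards2 ab1.
  by rewrite subset_leq_card // subUset !sub1set ina.
apply: leq_trans (_ : #|[set b | mu b == fpost b1]| <= 1).
  apply/subset_leq_card/subsetP => b; rewrite worse inE /mu'.
  case: eqP => [->|_]; first by rewrite ltnNge ltnW.
  case: eqP => [_|_]; first by rewrite place_fpost.
  case: ifP; last by rewrite ltnn.
  by case/existsP => b2 /andP[/eqP e2 /eqP <- _]; rewrite (inj _ _ _ e2 eb1).
have [p -> _] := fpostP b1.
by apply/card_le1P => b; rewrite inE => /eqP eb c; rewrite !inE; apply/eqP/eqP => [h|->//];
  apply: inj h eb.
Qed.

(** A post ahead of s(a) is an f-post, held by somebody who ranks it first, so [a] can hold it only
    if it is f(a). If [a] did worse than s(a), then by [popular_holder] somebody would rank s(a)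
    first, but s(a) is not an f-post. *)
Lemma popular_fs M a : popular M ->
  matched_post M a = fpost a \/ matched_post M a = spost a.
Proof.
move=> pM; have [mM _] := pM; have [acc inj] := matched_post_acceptable mM.
have holder p : is_fpost p ->
    exists b, matched_post M b = Some p /\ fpost b = Some p.
  case/existsP => b /eqP fb; have [p' e pb] := fpostP b.
  move: e; rewrite fb => -[e]; rewrite -e in pb.
  have [h|h] := eqVneq (matched_post M b) (fpost b); first by exists b; rewrite h.
  by apply: (popular_holder pM pb); rewrite -fb place_fpost lt0n place_eq0.
have [lt|gt|e] := ltngtP (place a (matched_post M a)) (place a (spost a)).
- left; case e: (matched_post M a) lt => [p|].
    by move/lt_spost_fpost/holder => [b [b1 <-]]; rewrite (inj _ _ _ e b1).
  rewrite /place; case: (spost a) (@spostP a) => [q|]; last by rewrite ltnn.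
  by move=> /(_ q erefl) [qa _]; rewrite ltnNge ltnW // index_mem.
- right; move: gt; case e: (spost a) => [q|].
    have [qa nq] := spostP e => /(popular_holder pM qa) [b [_ /is_fpostP]].
    by rewrite (negPf nq).
  rewrite /place; case e': (matched_post M a) => [p|] //.
  by move=> h; have := acc _ _ e'; rewrite -index_mem ltnNge ltnW.
- right; move: e; rewrite /place; case e1: (matched_post M a) => [p|];
    case e2: (spost a) => [q|] //.
  + move=> /(congr1 (nth p (pref a))).
    by rewrite !nth_index ?(acc _ _ e1) // ?(proj1 (spostP e2)) // => ->.
  + by move=> h; have := acc _ _ e1; rewrite -index_mem h ltnn.
  + by move=> h; have [] := spostP e2; rewrite -index_mem h ltnn.
Qed.

End PopularMatchings.

(** * Transitive closure by squaring, and 2-satisfiability *)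

Section Squaring.

Variables (T : finType) (e : rel T) (A : nat -> rel T).
Hypothesis A0 : forall u v, A 0 u v = (u == v) || e u v.
Hypothesis AS : forall t u v,
  A t.+1 u v = A t u v || [exists w, A t u w && A t w v].

Lemma squaring_sub_connect t u v : A t u v -> connect e u v.
Proof.
elim: t u v => [|t ih] u v.
  by rewrite A0 => /orP[/eqP->|/connect1//]; apply: connect0.
rewrite AS => /orP[/ih//|/existsP[w /andP[/ih uw /ih wv]]].
exact: connect_trans uw wv.
Qed.

(** Cutting a path of length at most [2 ^ t.+1] at position [2 ^ t] leaves two pieces covered by the
    induction hypothesis. *)
Lemma path_sub_squaring t u p : path e u p -> size p <= 2 ^ t -> A t u (last u p).
Proof.
elim: t u p => [|t ih] u p.
  rewrite A0; case: p => [|v [|]] //=; first by rewrite eqxx.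
  by rewrite andbT => -> _; rewrite orbT.
rewrite -{1 3}(cat_take_drop (2 ^ t) p) cat_path last_cat AS => /andP[p1 p2] sz.
apply/orP; right; apply/existsP; exists (last u (take (2 ^ t) p)).
rewrite !ih //; first by rewrite size_drop leq_subLR addnn -mul2n -expnS.
by rewrite size_take; case: ifP => // /negbT; rewrite -leqNgt.
Qed.

Lemma squaring_connect t : #|T| <= 2 ^ t -> A t =2 connect e.
Proof.
move=> leT u v; apply/idP/idP; first exact: squaring_sub_connect.
case/connectP => p0 /shortenP[p ep up _] ->; apply: path_sub_squaring => //.
have /card_uniqP /= sz := up; apply: leq_trans leT.
by apply: leq_trans (max_card [in u :: p]); rewrite sz.
Qed.

End Squaring.

(** * Satisfying assignments read off a closed implication relation *)

Section TwoSat.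

Variables (T : finType) (neg : T -> T) (r : rel T) (w : T -> nat).
Hypothesis negK : involutive neg.
Hypothesis r_refl : reflexive r.
Hypothesis r_trans : transitive r.
Hypothesis r_skew : forall u v, r u v -> r (neg v) (neg u).
Hypothesis w_inj : injective w.
Hypothesis w_gt0 : forall u, 0 < w u.

(** A literal with [r (neg v) v] is forced and offers no choice, so it is left out. Weights being
    positive, the value 0 of an empty maximum singles out the forced literals. *)
Definition height (u : T) : nat := \max_(v | r u v && ~~ r (neg v) v) w v.

Definition sat_val (u : T) : bool := height u < height (neg u).

Lemma height_mono u v : r u v -> height v <= height u.
Proof.
move=> uv; apply/bigmax_leqP => x /andP[vx nx].
by apply: (@leq_bigmax_cond _ _ w x); rewrite nx (r_trans uv vx).
Qed.

(** From [u] to [v] the height can only drop, while by skew symmetry that of the negation can only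
    rise. *)
Lemma sat_val_imp u v : r u v -> sat_val u -> sat_val v.
Proof.
move=> uv; rewrite /sat_val => lt; apply: leq_trans (height_mono (r_skew uv)).
exact: leq_ltn_trans (height_mono uv) lt.
Qed.

Hypothesis no_cycle : forall u, ~~ (r u (neg u) && r (neg u) u).

Lemma height_attained u : r (neg u) u || [exists v,
  [&& r u v, ~~ r (neg v) v & height u == w v]].
Proof.
case: (boolP (r (neg u) u)) => //= nu; apply/existsP.
have [|v /andP[uv nv] e] := @eq_bigmax_cond _ [pred v | r u v && ~~ r (neg v) v] w.
  by apply/card_gt0P; exists u; rewrite inE r_refl nu.
by exists v; rewrite uv nv /height e eqxx.
Qed.

(* A literal reachable from both [u] and [neg u] is reachable from its own
   negation, hence discarded from the maxima. *)
Lemma height_neg u : height u != height (neg u).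
Proof.
(* Whatever a forced literal [v] reaches is forced too, along [neg x], [neg v], [v], [x], so the
   maximum is empty. *)
have noh v : r (neg v) v -> height v = 0.
  move=> vv; apply/eqP; rewrite -leqn0; apply/bigmax_leqP => x /andP[vx].
  by rewrite (r_trans (r_trans (r_skew vx) vv) vx).
have [/noh e|/existsP[v /and3P[uv nv /eqP e]]] := orP (height_attained u);
have [|/existsP[v' /and3P[uv' nv' /eqP e']]] := orP (height_attained (neg u)).
- rewrite negK => h; have := no_cycle u; rewrite h /=; apply: contraNneq => _.
  have := height_attained u; case/orP => // /existsP[v /and3P[_ _]].
  by rewrite e eq_sym => /eqP h0; have := w_gt0 v; rewrite h0.
- by rewrite e e' neq_ltn w_gt0.
- by rewrite negK => h; rewrite e [height (neg u)]noh ?negK // neq_ltn w_gt0 orbT.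
rewrite e e'; apply/eqP => /w_inj ev; rewrite -ev in uv'.
by case/negP: nv; apply: r_trans uv; have := r_skew uv'; rewrite negK.
Qed.

Lemma sat_val_neg u : sat_val (neg u) = ~~ sat_val u.
Proof.
by rewrite /sat_val negK -leqNgt [RHS]leq_eqVlt eq_sym (negPf (height_neg u)).
Qed.

End TwoSat.

(** * Compiling expressions in lock step *)

Lemma updateE f x v y : update f x v y = if y == x then v else f y.
Proof. by []. Qed.

(** Jump targets are absolute, so code is compiled for a definite line of the whole program. *)
Definition code_at (pr : program) (l : nat) (code : program) : Prop :=
  exists pre post, pr = pre ++ code ++ post /\ size pre = l.

Lemma code_at_cat pr l c1 c2 : code_at pr l (c1 ++ c2) ->
  code_at pr l c1 /\ code_at pr (l + size c1) c2.
Proof.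
case=> pre [post [-> <-]]; split.
  by exists pre, (c2 ++ post); rewrite -catA.
by exists (pre ++ c1), post; rewrite size_cat !catA.
Qed.

Lemma code_at_cons pr l i c : code_at pr l (i :: c) ->
  nth Halt pr l = i /\ code_at pr l.+1 c.
Proof.
case=> pre [post [-> <-]]; split; first by rewrite nth_cat ltnn subnn.
by exists (rcons pre i), post; rewrite size_rcons cat_rcons.
Qed.

Lemma code_at_nth pr l c k : code_at pr l c -> k < size c ->
  nth Halt pr (l + k) = nth Halt c k.
Proof.
case=> pre [post [-> <-]] lt_k; rewrite nth_cat -ltn_subRL subnn ltn0 addKn.
by rewrite nth_cat lt_k.
Qed.

(** While no processor writes, the memory is constant and each processor can be followed on its own;
    [run_silent] puts such runs together. *)
Definition silent_steps pr m t s s' : Prop :=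
  iter t (proc_step pr m) s = s' /\
  forall i, i < t -> proc_write pr (iter i (proc_step pr m) s) = None.

Lemma silent_steps_trans pr m t1 t2 s1 s2 s3 :
  silent_steps pr m t1 s1 s2 -> silent_steps pr m t2 s2 s3 ->
  silent_steps pr m (t1 + t2) s1 s3.
Proof.
move=> [e1 w1] [e2 w2]; split; first by rewrite addnC iterD e1.
move=> i lti; case: (ltnP i t1) => [/w1 //|le_i].
by rewrite -(subnK le_i) iterD e1 w2 // ltn_subLR.
Qed.

Lemma silent_stepsS pr m t s s' s'' :
  proc_write pr s = None -> proc_step pr m s = s' ->
  silent_steps pr m t s' s'' -> silent_steps pr m t.+1 s s''.
Proof.
move=> w e h; rewrite -add1n; apply: silent_steps_trans h; split => //.
by case.
Qed.

Lemma silent_steps0 pr m s : silent_steps pr m 0 s s.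
Proof. by []. Qed.

Inductive expr : Type :=
| Var of nat
| Cst of nat
| EAdd of expr & expr
| ESub of expr & expr
| EHalf of expr
| ERead of expr
| EIf of expr & expr & expr.

Fixpoint eval (e : expr) (g m : nat -> nat) : nat :=
  match e with
  | Var r => g r
  | Cst c => c
  | EAdd a b => eval a g m + eval b g m
  | ESub a b => eval a g m - eval b g m
  | EHalf a => (eval a g m)./2
  | ERead a => m (eval a g m)
  | EIf c a b => if eval c g m == 0 then eval b g m else eval a g m
  end.

(* Even registers hold program variables, odd ones the evaluation stack. *)
Definition tmp (d : nat) : nat := d.*2.+1.

(* Both branches of the select take three steps, so that the processors stay
   in lock step whatever the condition; so do the two outcomes of a predicated
   write below. *)
Definition select_code (l d : nat) : program :=
  [:: Const (tmp d.+3) 0; JumpZ (tmp d) (l + 4);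
      Add (tmp d) (tmp d.+1) (tmp d.+3); JumpZ (tmp d.+3) (l + 6);
      Add (tmp d) (tmp d.+2) (tmp d.+3); Const (tmp d.+3) 0].

Fixpoint compile_expr (l d : nat) (e : expr) : program :=
  match e with
  | Var r => [:: Const (tmp d) 0; Add (tmp d) (tmp d) r.*2]
  | Cst c => [:: Const (tmp d) c]
  | EAdd a b =>
      let ca := compile_expr l d a in
      let cb := compile_expr (l + size ca) d.+1 b in
      ca ++ cb ++ [:: Add (tmp d) (tmp d) (tmp d.+1)]
  | ESub a b =>
      let ca := compile_expr l d a in
      let cb := compile_expr (l + size ca) d.+1 b in
      ca ++ cb ++ [:: Defs.Sub (tmp d) (tmp d) (tmp d.+1)]
  | EHalf a => compile_expr l d a ++ [:: Half (tmp d) (tmp d)]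
  | ERead a => compile_expr l d a ++ [:: Read (tmp d) (tmp d)]
  | EIf c a b =>
      let cc := compile_expr l d c in
      let ca := compile_expr (l + size cc) d.+1 a in
      let cb := compile_expr (l + size cc + size ca) d.+2 b in
      cc ++ ca ++ cb ++ select_code (l + size cc + size ca + size cb) d
  end.

Fixpoint expr_time (e : expr) : nat :=
  match e with
  | Var _ => 2
  | Cst _ => 1
  | EAdd a b | ESub a b => expr_time a + (expr_time b + 1)
  | EHalf a | ERead a => expr_time a + 1
  | EIf c a b => expr_time c + (expr_time a + (expr_time b + 4))
  end.

Definition evaluated (g : nat -> nat) (d v : nat) (g' : nat -> nat) : Prop :=
  [/\ g' (tmp d) = v, forall r, g' r.*2 = g r.*2 &
      forall k, k < d -> g' (tmp k) = g (tmp k)].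

Lemma evaluated_trans g1 g2 g3 d d' v v' :
  evaluated g1 d v g2 -> evaluated g2 d' v' g3 -> d < d' ->
  evaluated g1 d v g3 /\ g3 (tmp d') = v'.
Proof.
move=> [v2 r2 k2] [v3 r3 k3] ltd; split=> //; split=> [|r|k ltk].
- by rewrite k3.
- by rewrite r3.
- by rewrite k3 ?k2 // (ltn_trans ltk).
Qed.

Lemma tmp_eq i j : (tmp i == tmp j) = (i == j).
Proof. rewrite /tmp; lia. Qed.

Lemma var_tmp i j : (i.*2 == tmp j) = false.
Proof. rewrite /tmp; lia. Qed.

Lemma tmp_var i j : (tmp j == i.*2) = false.
Proof. rewrite /tmp; lia. Qed.

Lemma double_eq i j : (i.*2 == j.*2) = (i == j).
Proof. lia. Qed.

Definition regE := (updateE, tmp_eq, var_tmp, tmp_var, double_eq, eqxx).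

Lemma select_ok pr l d m g : code_at pr l (select_code l d) ->
  exists g', silent_steps pr m 4 (Proc l g) (Proc (l + 6) g') /\
    evaluated g d (if g (tmp d) == 0 then g (tmp d.+2) else g (tmp d.+1)) g'.
Proof.
move=> /code_at_nth h.
have h0 := h 0 isT; have h1 := h 1 isT; have h2 := h 2 isT; have h3 := h 3 isT.
have h4 := h 4 isT; have h5 := h 5 isT; rewrite addn0 addn1 addn2 addn3 /= in h0 h1 h2 h3.
rewrite /= in h4 h5; pose g1 := update g (tmp d.+3) 0.
have n3 : (d == d.+3) = false by lia.
have n3' : (d.+3 == d) = false by lia.
have n1 : (d.+1 == d.+3) = false by lia.
have n2 : (d.+2 == d.+3) = false by lia.
have e0 : g1 (tmp d) = g (tmp d) by rewrite /g1 !regE n3.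
have e1 : g1 (tmp d.+1) = g (tmp d.+1) by rewrite /g1 !regE n1.
have e2 : g1 (tmp d.+2) = g (tmp d.+2) by rewrite /g1 !regE n2.
have e3 : g1 (tmp d.+3) = 0 by rewrite /g1 !regE.
case: eqP => [g0|/eqP/negPf gN0].
  exists (update (update g1 (tmp d) (g (tmp d.+2))) (tmp d.+3) 0); split.
    apply: (@silent_stepsS _ _ _ _ (Proc l.+1 g1));
      rewrite /proc_write /proc_step /fetch /= ?h0 //=.
    apply: (@silent_stepsS _ _ _ _ (Proc (l + 4) g1));
      rewrite /proc_write /proc_step /fetch /= ?h1 //= ?e0 ?g0 //=.
    apply: (@silent_stepsS _ _ _ _ (Proc (l + 4).+1 (update g1 (tmp d) (g (tmp d.+2)))));
      rewrite /proc_write /proc_step /fetch /= ?h4 //= ?e2 ?e3 ?addn0 //=.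
    apply: silent_stepsS;
      rewrite /proc_write /proc_step /fetch /= -?addnS ?h5 //=.
  by split=> [|r|k lk]; rewrite ?/g1 !regE ?n3 ?(ltn_eqF lk) ?ltn_eqF //; lia.
exists (update g1 (tmp d) (g (tmp d.+1))); split.
  apply: (@silent_stepsS _ _ _ _ (Proc l.+1 g1));
    rewrite /proc_write /proc_step /fetch /= ?h0 //=.
  apply: (@silent_stepsS _ _ _ _ (Proc l.+2 g1));
    rewrite /proc_write /proc_step /fetch /= ?h1 //= ?e0 ?gN0 //=.
  apply: (@silent_stepsS _ _ _ _ (Proc l.+3 (update g1 (tmp d) (g (tmp d.+1)))));
    rewrite /proc_write /proc_step /fetch /= ?h2 //= ?e1 ?e3 ?addn0 //=.
  (* [tmp d.+3] holds 0, so this [JumpZ] is unconditional and skips the other branch. *)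
  apply: silent_stepsS;
    rewrite /proc_write /proc_step /fetch /= ?h3 //= ?regE ?n3' ?e3 //=.
by split=> [|r|k lk]; rewrite ?/g1 !regE ?n3 ?(ltn_eqF lk) ?ltn_eqF //; lia.
Qed.

Definition computes pr m (sig : nat -> nat) (t : nat) (c : nat -> nat -> program) (v : nat) :=
  forall l d g, code_at pr l (c l d) -> (forall r, g r.*2 = sig r) ->
  exists g', silent_steps pr m t (Proc l g) (Proc (l + size (c l d)) g') /\
    evaluated g d v g'.

Lemma computes_binop pr m sig op f ta tb ca cb va vb :
  (forall d l g, nth Halt pr l = op (tmp d) (tmp d) (tmp d.+1) ->
     proc_write pr (Proc l g) = None /\
     proc_step pr m (Proc l g) =
       Proc l.+1 (update g (tmp d) (f (g (tmp d)) (g (tmp d.+1))))) ->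
  computes pr m sig ta ca va -> computes pr m sig tb cb vb ->
  computes pr m sig (ta + (tb + 1))
    (fun l d => ca l d ++ cb (l + size (ca l d)) d.+1 ++
                [:: op (tmp d) (tmp d) (tmp d.+1)]) (f va vb).
Proof.
move=> hop iha ihb l d g /code_at_cat [ha /code_at_cat[hb /code_at_cons [hc _]]] hg.
have [ga [sa ea]] := iha l d g ha hg.
have ra r : ga r.*2 = sig r by case: ea => _ -> _.
have [gb [sb eb]] := ihb _ _ ga hb ra.
have [[va' rb kb] vb'] := evaluated_trans ea eb (ltnSn d).
have [w1 s1] := hop d _ gb hc.
eexists; split.
  apply: silent_steps_trans sa _; apply: silent_steps_trans sb _.
  apply: silent_stepsS w1 s1 _.
  by rewrite !size_cat /= addn1 !addnS !addnA; apply: silent_steps0.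
split=> [|r|k lk]; rewrite !regE.
- by rewrite va' vb'.
- by rewrite rb.
- by rewrite ltn_eqF // kb.
Qed.

Lemma computes_unop pr m sig op f ta ca va :
  (forall d l g, nth Halt pr l = op (tmp d) (tmp d) ->
     proc_write pr (Proc l g) = None /\
     proc_step pr m (Proc l g) = Proc l.+1 (update g (tmp d) (f (g (tmp d))))) ->
  computes pr m sig ta ca va ->
  computes pr m sig (ta + 1) (fun l d => ca l d ++ [:: op (tmp d) (tmp d)]) (f va).
Proof.
move=> hop iha l d g /code_at_cat [ha /code_at_cons [hc _]] hg.
have [ga [sa [va' ra ka]]] := iha l d g ha hg.
have [w1 s1] := hop d _ ga hc.
eexists; split.
  apply: silent_steps_trans sa _; apply: silent_stepsS w1 s1 _.
  by rewrite !size_cat /= addn1 !addnS; apply: silent_steps0.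
split=> [|r|k lk]; rewrite !regE.
- by rewrite va'.
- by rewrite ra.
- by rewrite ltn_eqF // ka.
Qed.

Lemma compile_expr_ok pr m sig e :
  computes pr m sig (expr_time e) (fun l d => compile_expr l d e) (eval e sig m).
Proof.
have fetchE l i (h : nth Halt pr l = i) g : fetch pr (Proc l g) = i by [].
elim: e => [r|c|a iha b ihb|a iha b ihb|a iha|a iha|c ihc a iha b ihb].
- move=> l d g /code_at_cons [h1 /code_at_cons [h2 _]] hg; eexists; split.
    apply: silent_stepsS; rewrite /proc_write /proc_step ?(fetchE _ _ h1) //=.
    apply: silent_stepsS; rewrite /proc_write /proc_step ?(fetchE _ _ h2) //=.
    by rewrite addn2; apply: silent_steps0.
  split=> [|r'|k lk]; rewrite !regE ?hg //.
  by rewrite ltn_eqF.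
- move=> l d g /code_at_cons [h1 _] hg; eexists; split.
    apply: silent_stepsS; rewrite /proc_write /proc_step ?(fetchE _ _ h1) //=.
    by rewrite addn1; apply: silent_steps0.
  split=> [|r'|k lk]; rewrite !regE ?hg //.
  by rewrite ltn_eqF.
- apply: computes_binop iha ihb => d l g h.
  by rewrite /proc_write /proc_step !(fetchE _ _ h).
- apply: computes_binop iha ihb => d l g h.
  by rewrite /proc_write /proc_step !(fetchE _ _ h).
- apply: computes_unop iha => d l g h.
  by rewrite /proc_write /proc_step !(fetchE _ _ h).
- apply: (computes_unop (f := m)) iha => d l g h.
  by rewrite /proc_write /proc_step !(fetchE _ _ h).
move=> l d g /code_at_cat [hc /code_at_cat [ha /code_at_cat [hb hs]]] hg.
have [gc [sc ec]] := ihc _ _ _ hc hg.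
have rc r : gc r.*2 = sig r by case: ec => _ -> _.
have [ga [sa ea]] := iha _ _ _ ha rc.
have ra r : ga r.*2 = sig r by case: ea => _ -> _.
have [gb [sb eb]] := ihb _ _ _ hb ra.
have [ea' vb] := evaluated_trans ea eb (ltnSn _).
have [[vc rc' kc] va] := evaluated_trans ec ea' (ltnSn _).
have [g' [ss [vs rs ks]]] := select_ok m gb hs.
exists g'; split.
  rewrite /= !size_cat; apply: silent_steps_trans sc _.
  apply: silent_steps_trans sa _; apply: silent_steps_trans sb _.
  by rewrite !addnA.
split=> [|r|k lk].
- by rewrite vs vc vb va.
- by rewrite rs rc'.
- by rewrite ks ?kc.
Qed.

(** * Compiling statements in lock step *)

Inductive stmt : Type :=
| Assign of nat & expr
| Store of expr & expr & expr      (* Store c a v : if c != 0, shared[a] := v *)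
| Seq of stmt & stmt
| While of nat & stmt.

Definition store_code (l : nat) : program :=
  [:: Const (tmp 3) 0; JumpZ (tmp 0) (l + 4); Defs.Write (tmp 1) (tmp 2);
      JumpZ (tmp 3) (l + 6); Const (tmp 3) 0; Const (tmp 3) 0].

Fixpoint compile (l : nat) (s : stmt) : program :=
  match s with
  | Assign r e =>
      compile_expr l 0 e ++ [:: Const r.*2 0; Add r.*2 r.*2 (tmp 0)]
  | Store c a v =>
      let cc := compile_expr l 0 c in
      let ca := compile_expr (l + size cc) 1 a in
      let cv := compile_expr (l + size cc + size ca) 2 v in
      cc ++ ca ++ cv ++ store_code (l + size cc + size ca + size cv)
  | Seq s1 s2 =>
      let c1 := compile l s1 in c1 ++ compile (l + size c1) s2
  | While r s =>
      let c := compile l.+1 s in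
      JumpZ r.*2 (l.+1 + size c).+2 :: c ++
      [:: Const (tmp 0) 0; JumpZ (tmp 0) l]
  end.

(* Time per round, loops being charged for a single iteration. *)
Fixpoint round_time (s : stmt) : nat :=
  match s with
  | Assign _ e => expr_time e + 2
  | Store c a v => expr_time c + expr_time a + expr_time v + 4
  | Seq s1 s2 => round_time s1 + round_time s2
  | While _ s => round_time s + 4
  end.

Lemma pmap_map (A B C : Type) (f : B -> option C) (g : A -> B) s :
  pmap f (map g s) = pmap (fun x => f (g x)) s.
Proof. by elim: s => //= x s ->. Qed.

Lemma eq_in_pmap (A : eqType) (B : Type) (f g : A -> option B) s :
  {in s, f =1 g} -> pmap f s = pmap g s.
Proof.
elim: s => //= x s ih h; rewrite h ?mem_head // ih // => y ys.
by rewrite h // inE ys orbT.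
Qed.

(* The effect on a memory of a priority-resolved parallel write, in which
   processor [p] stores [v p] at [a p] if [c p]. *)
Definition scatter (P : nat) (c : nat -> bool) (a v old : nat -> nat) : nat -> nat :=
  let writes := pmap (fun p => if c p then Some (a p, v p) else None) (iota 0 P) in
  fun x => head (old x) [seq w.2 | w <- writes & w.1 == x].

Section Lockstep.

Variable P : nat.

Definition conf (st : nat -> proc) (m : nat -> nat) : config :=
  Config [seq st p | p <- iota 0 P] m.

Lemma step_conf pr st m :
  step pr (conf st m) = conf (fun p => proc_step pr m (st p))
    (fun x => head (m x) [seq w.2 | w <-
       pmap (fun p => proc_write pr (st p)) (iota 0 P) & w.1 == x]).
Proof. by rewrite /step /= pmap_map -map_comp. Qed.

Lemma run_silent pr m t st (Q : nat -> proc -> Prop) :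
  (forall p, p < P -> exists2 s', silent_steps pr m t (st p) s' & Q p s') ->
  exists2 st', run pr t (conf st m) = conf st' m & forall p, p < P -> Q p (st' p).
Proof.
move=> h; pose st' i p := iter i (proc_step pr m) (st p).
have hrun i : i <= t -> run pr i (conf st m) = conf (st' i) m.
  elim: i => [//|i ih] lei.
  rewrite -[run _ _ _]/(step pr (run pr i (conf st m))) ih 1?ltnW //.
  rewrite step_conf /= (_ : pmap _ _ = [::]) // (@eq_in_pmap _ _ _ (fun=> None)).
    by elim: (iota _ _).
  move=> p; rewrite mem_iota => /andP[_ /h[s' [_ hw] _]].
  by apply: hw.
exists (st' t); first exact: hrun.
by move=> p /h[s' [<- _]].
Qed.

Definition state := ((nat -> nat -> nat) * (nat -> nat))%type.

Definition at_line (l : nat) (g : nat -> nat -> nat) (st : nat -> proc) : Prop :=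
  forall p, p < P -> pc (st p) = l /\ forall r, reg (st p) r.*2 = g p r.

Lemma run_silent_at pr m t st l g :
  (forall p, p < P -> exists2 s', silent_steps pr m t (st p) s' &
     pc s' = l /\ forall r, reg s' r.*2 = g p r) ->
  exists2 st', run pr t (conf st m) = conf st' m & at_line l g st'.
Proof.
exact: (@run_silent _ _ _ _ (fun p s => pc s = l /\ forall r, reg s r.*2 = g p r)).
Qed.

(** [K] bounds the number of rounds of each loop. The time is common to all processors, and only
    even registers are constrained, which leaves the contents of the stack open. *)
Definition exec (K : nat) (s : stmt) (sig sig' : state) : Prop :=
  exists2 t, t <= K * round_time s &
  forall pr l, code_at pr l (compile l s) ->
  forall st, at_line l sig.1 st ->
  exists2 st', run pr t (conf st sig.2) = conf st' sig'.2 &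
               at_line (l + size (compile l s)) sig'.1 st'.

Lemma run_add pr t1 t2 c : run pr (t1 + t2) c = run pr t2 (run pr t1 c).
Proof. by rewrite /run addnC iterD. Qed.

Lemma exec_seq K s1 s2 sig1 sig2 sig3 :
  exec K s1 sig1 sig2 -> exec K s2 sig2 sig3 -> exec K (Seq s1 s2) sig1 sig3.
Proof.
move=> [t1 le1 h1] [t2 le2 h2]; exists (t1 + t2); first by rewrite mulnDr leq_add.
move=> pr l /code_at_cat [c1 c2] st hst.
have [st1 r1 a1] := h1 _ _ c1 _ hst; have [st2 r2 a2] := h2 _ _ c2 _ a1.
by exists st2; rewrite ?run_add ?r1 //= size_cat addnA.
Qed.

Lemma exec_assign K r e g m : 0 < K ->
  exec K (Assign r e) (g, m) (fun p => update (g p) r (eval e (g p) m), m).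
Proof.
move=> K0; exists (expr_time e + 2); first by rewrite leq_pmull.
move=> pr l /code_at_cat[ce /code_at_cons [h1 /code_at_cons [h2 _]]] st hst.
apply: run_silent_at => p /hst; case: (st p) => l' g' /= [-> hg].
have [g1 [s1 [v1 r1 _]]] := compile_expr_ok m ce hg; eexists.
  apply: silent_steps_trans s1 _.
  apply: silent_stepsS; rewrite /proc_write /proc_step /fetch /= ?h1 //=.
  apply: silent_stepsS; rewrite /proc_write /proc_step /fetch /= ?h2 //=.
split=> [|r'] /=; first by rewrite size_cat addnA addn2.
by rewrite !regE v1 add0n r1 hg; case: eqP.
Qed.

Lemma exec_store K c a v g m : 0 < K ->
  exec K (Store c a v) (g, m)
    (g, scatter P (fun p => eval c (g p) m != 0) (fun p => eval a (g p) m)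
                  (fun p => eval v (g p) m) m).
Proof.
move=> K0; set T := expr_time c + expr_time a + expr_time v.
exists (T + 4); first by rewrite leq_pmull.
move=> pr l /code_at_cat[cc /code_at_cat [ca /code_at_cat[cv /code_at_nth hs]]] st hst.
rewrite /= !size_cat !addnA; move: hs; set l' := l + _ + _ + _ => hs.
have h0 := hs 0 isT; have h1 := hs 1 isT; have h2 := hs 2 isT; have h3 := hs 3 isT.
have h4 := hs 4 isT; have h5 := hs 5 isT; rewrite addn0 addn1 addn2 addn3 /= in h0 h1 h2 h3.
rewrite /= in h4 h5.
pose b p := eval c (g p) m == 0.
pose Q p s := [/\ pc s = (if b p then l' + 4 else l'.+2),
  forall r, reg s r.*2 = g p r, reg s (tmp 1) = eval a (g p) m,
  reg s (tmp 2) = eval v (g p) m & reg s (tmp 3) = 0].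
(* After [T + 2] steps the processors have split: the writing ones stand at the [Write], the others
   at a filler instruction. The next step is the only one that touches the memory. *)
have [st1 run1 hst1] : exists2 st', run pr (T + 2) (conf st m) = conf st' m &
    forall p, p < P -> Q p (st' p).
  apply: run_silent => p /hst; case: (st p) => l1 g0 /= [-> hg].
  have [gc [sc ec]] := compile_expr_ok m cc hg.
  have rc r : gc r.*2 = g p r by case: ec => _ -> _.
  have [ga [sa ea]] := compile_expr_ok m ca rc.
  have ra r : ga r.*2 = g p r by case: ea => _ -> _.
  have [gv [sv ev]] := compile_expr_ok m cv ra.
  have [ea' vv] := evaluated_trans ea ev (ltnSn _).
  have [[vc rv _] va] := evaluated_trans ec ea' (ltnSn _).
  exists (Proc (if b p then l' + 4 else l'.+2) (update gv (tmp 3) 0)).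
    have -> : T + 2 = expr_time c + (expr_time a + (expr_time v + 2)).
      by rewrite /T !addnA.
    apply: silent_steps_trans sc _.
    apply: silent_steps_trans sa _; apply: silent_steps_trans sv _.
    apply: (@silent_stepsS _ _ _ _ (Proc l'.+1 (update gv (tmp 3) 0)));
      rewrite /proc_write /proc_step /fetch /= ?h0 //=.
    apply: silent_stepsS (silent_steps0 _ _ _);
      rewrite /proc_write /proc_step /fetch /= h1 //=.
    by rewrite regE /= vc.
  by split=> [|r|||]; rewrite /= ?regE //= rv.
set m' := scatter _ _ _ _ _.
have [st2 run2 hst2] : exists2 st', run pr 1 (conf (fun p => proc_step pr m (st1 p)) m')
    = conf st' m' & at_line (l' + 6) g st'.
  apply: run_silent_at => p /hst1; case: (st1 p) => l1 g0 [/= -> rg _ _ g3].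
  have -> : proc_step pr m (Proc (if b p then l' + 4 else l'.+2) g0) =
    if b p then Proc (l' + 5) (update g0 (tmp 3) 0) else Proc l'.+3 g0.
    by case: (b p); rewrite /proc_step /fetch /= ?h4 ?h2 //= -addnS.
  case: (b p).
    exists (Proc (l' + 6) (update (update g0 (tmp 3) 0) (tmp 3) 0)); last first.
      by split=> //= r; rewrite !regE.
    by apply: silent_stepsS (silent_steps0 _ _ _);
      rewrite /proc_write /proc_step /fetch /= h5 //= -addnS.
  exists (Proc (l' + 6) g0) => //.
  by apply: silent_stepsS (silent_steps0 _ _ _);
    rewrite /proc_write /proc_step /fetch /= h3 //= g3.
exists st2 => //.
rewrite -run2 -[T + 4]/(T + (2 + 2)) addnA run_add run1 -[2]/(1 + 1) run_add.
congr run; rewrite -[run pr 1 _]/(step pr (conf st1 m)) step_conf.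
congr Config; congr (fun w x => head (m x) [seq w.2 | w <- w & w.1 == x]).
apply: eq_in_pmap => p; rewrite mem_iota => /andP[_ /hst1].
case: (st1 p) => l1 g0 [/= -> rg g1 g2 _]; rewrite /proc_write /fetch /= /b.
by case: eqP => /= _; rewrite ?h4 ?h2 //= g1 g2.
Qed.

(** The condition on [r] makes all processors leave the loop at the same round. *)
Lemma exec_while K n r s (sig : nat -> state) : n < K ->
  (forall i p, i <= n -> p < P -> ((sig i).1 p r == 0) = (i == n)) ->
  (forall i, i < n -> exec 1 s (sig i) (sig i.+1)) ->
  exec K (While r s) (sig 0) (sig n).
Proof.
move=> ltnK hr hs.
(* Induction on the number [k] of rounds still to go, since each of them starts at the same line.
   The final test costs the extra 1, which [n < K] absorbs as one more round. *)
suff h k : k <= n -> exists2 t, t <= k * (round_time s + 4) + 1 &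
  forall pr l, code_at pr l (compile l (While r s)) ->
  forall st, at_line l (sig (n - k)).1 st ->
  exists2 st', run pr t (conf st (sig (n - k)).2) = conf st' (sig n).2 &
    at_line (l + size (compile l (While r s))) (sig n).1 st'.
  have [t let1 ht] := h n (leqnn n); rewrite subnn in ht; exists t => //=.
  apply: leq_trans let1 (leq_trans _ (leq_mul ltnK (leqnn _))).
  by rewrite mulSn addnC leq_add2r addn4.
elim: k => [_|k ih ltkn].
  exists 1 => // pr l /= /code_at_cons[h1 _] st hst; rewrite subn0 in hst *.
  rewrite -[step _ _]/(run pr 1 _); apply: run_silent_at => p ltp.
  have := hst p ltp; case: (st p) => l' g' /= [-> hg].
  exists (Proc ((l.+1 + size (compile l.+1 s)).+2) g').
    apply: silent_stepsS (silent_steps0 _ _ _);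
      rewrite /proc_write /proc_step /fetch /= h1 //=.
    by rewrite hg hr // eqxx.
  by split=> //=; rewrite size_cat /= addn2 !addnS addSn.
have [t2 le2 h2] := ih (ltnW ltkn).
have e : (n - k.+1).+1 = n - k by rewrite -subSn.
have [|t1 le1 h1] := hs (n - k.+1); first by rewrite -subn_gt0 subKn.
rewrite mul1n in le1; rewrite e in h1.
exists (1 + t1 + 2 + t2); first by rewrite mulSn; lia.
move=> pr l hcode st hst; have /code_at_cons[i1] := hcode.
move=> /code_at_cat [hbody /code_at_cons[i2 /code_at_cons[i3 _]]].
have [st1 run1 hst1] : exists2 st', run pr 1 (conf st (sig (n - k.+1)).2) =
    conf st' (sig (n - k.+1)).2 & at_line l.+1 (sig (n - k.+1)).1 st'.
  apply: run_silent_at => p ltp; have := hst p ltp; case: (st p) => l' g' /= [-> hg].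
  exists (Proc l.+1 g') => //.
  apply: silent_stepsS (silent_steps0 _ _ _);
      rewrite /proc_write /proc_step /fetch /= i1 //=.
  by rewrite hg hr ?leq_subr // ifN //; lia.
have [st2 run2 hst2] := h1 _ _ hbody _ hst1.
have [st3 run3 hst3] : exists2 st', run pr 2 (conf st2 (sig (n - k)).2) =
    conf st' (sig (n - k)).2 & at_line l (sig (n - k)).1 st'.
  apply: run_silent_at => p ltp; have := hst2 p ltp.
  case: (st2 p) => l' g' /= [-> hg].
  exists (Proc l (update g' (tmp 0) 0)); last by split=> // r'; rewrite /= !regE.
  apply: (@silent_stepsS _ _ _ _
      (Proc (l.+1 + size (compile l.+1 s)).+1 (update g' (tmp 0) 0)));
    rewrite /proc_write /proc_step /fetch /= ?i2 //=.
  apply: silent_stepsS (silent_steps0 _ _ _);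
    by rewrite /proc_write /proc_step /fetch /= i3 //= regE eqxx.
have [st4 run4 hst4] := h2 _ _ hcode _ hst3.
by exists st4 => //; rewrite !run_add run1 run2 run3 run4.
Qed.

End Lockstep.

(** * Priority writes on a grid of processors *)

Lemma scatterE P c a v old x : scatter P c a v old x =
  head (old x) [seq v p | p <- iota 0 P & c p && (a p == x)].
Proof.
rewrite /scatter; congr head; elim: (iota 0 P) => //= p s ih.
by case: (c p) => //=; case: ifP => //= _; rewrite ih.
Qed.

Lemma eq_scatter P (c c' : nat -> bool) (a a' v v' : nat -> nat) old :
  (forall p, p < P -> c p = c' p) ->
  (forall p, p < P -> c p -> a p = a' p) ->
  (forall p, p < P -> c p -> v p = v' p) ->
  scatter P c a v old =1 scatter P c' a' v' old.
Proof.
move=> ec ea ev x; rewrite !scatterE; congr head.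
rewrite (@eq_in_filter _ _ (fun p => c' p && (a' p == x))) => [|p]; last first.
  rewrite mem_iota => /andP[_ ltp]; rewrite -ec //.
  by case: (boolP (c p)) => //= cp; rewrite ea.
apply/eq_in_map => p; rewrite mem_filter mem_iota => /andP[/andP[cp _]] /andP[_ ltp].
by rewrite ev // ec.
Qed.

Lemma scatterP P (c : nat -> bool) (a v : nat -> nat) old x :
  ((forall p, p < P -> c p -> a p <> x) /\ scatter P c a v old x = old x) \/
  exists p, [/\ p < P, c p, a p = x, forall q, q < p -> c q -> a q <> x &
    scatter P c a v old x = v p].
Proof.
rewrite scatterE; pose b p := c p && (a p == x).
have [ex|nex] := boolP [exists p : 'I_P, b p]; last first.
  left; have nb p : p < P -> b p = false.
    by move=> ltp; apply: contraNF nex => bp; apply/existsP; exists (Ordinal ltp).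
  split=> [p ltp cp ap|]; first by have := nb p ltp; rewrite /b cp ap eqxx.
  rewrite (@eq_in_filter _ _ pred0) ?filter_pred0 // => p.
  by rewrite mem_iota => /andP[_ /nb].
have exP : exists p, (p < P) && b p.
  by have /existsP[[p ltp] bp] := ex; exists p; rewrite ltp.
case: (ex_minnP exP) => p /andP[ltp /andP[cp /eqP ap]] minp.
have nb q : q < p -> b q = false.
  move=> ltq; apply/negP => bq; have := minp q; rewrite bq (ltn_trans ltq ltp).
  by move=> /(_ isT); rewrite leqNgt ltq.
right; exists p; split=> // [q ltq cq aq|].
  by have := nb q ltq; rewrite /b cq aq eqxx.
rewrite -(subnKC (ltnW ltp)) iotaD filter_cat (@eq_in_filter _ _ pred0 (iota 0 p)).
  by rewrite filter_pred0 add0n -(subnSK ltp) /= cp ap eqxx.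
by move=> q; rewrite mem_iota => /andP[_ /nb].
Qed.

Section Grid.

Variables (P W : nat).
Hypothesis W_gt0 : 0 < W.
Hypothesis P_large : W * W * W <= P.

Definition col (p : nat) : nat := p %% W.
Definition row (p : nat) : nat := p %/ W %% W.
(** The last reduction makes processors beyond [W * W * W] wrap around, so that they repeat the
    writes of earlier ones. *)
Definition slab (p : nat) : nat := p %/ W %/ W %% W.

Lemma grid_pid i j k : i < W -> j < W -> k < W ->
  exists p, [/\ p < P, row p = i, col p = j & slab p = k].
Proof.
move=> lti ltj ltk; exists ((k * W + i) * W + j); rewrite /row /col /slab.
rewrite !modnMDl !divnMDl // (divn_small ltj) addn0 modnMDl divnMDl //.
rewrite (divn_small lti) addn0 !modn_small //; split=> //.
by apply: leq_trans P_large; nia.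
Qed.

(** The column is the lowest digit of the processor number, so priority favours the least column. *)
Lemma grid_shift p j : j < col p ->
  exists q, [/\ q < p, row q = row p, col q = j & slab q = slab p].
Proof.
move=> ltj; have ltp : col p < W by rewrite ltn_mod.
have ltjW := ltn_trans ltj ltp; exists (p %/ W * W + j).
rewrite /row /col /slab divnMDl // (divn_small ltjW) addn0 modnMDl (modn_small ltjW).
by split=> //; rewrite [ltnRHS](divn_eq p W) ltn_add2l.
Qed.

Definition grid_scatter (c : nat -> nat -> nat -> bool)
    (a v : nat -> nat -> nat -> nat) : (nat -> nat) -> nat -> nat :=
  scatter P (fun p => c (row p) (col p) (slab p))
            (fun p => a (row p) (col p) (slab p))
            (fun p => v (row p) (col p) (slab p)).

(** Which of several competing triples wins is left open; where it matters, [grid_scatter_min] is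
    used instead. *)
Variant grid_scatter_spec (c : nat -> nat -> nat -> bool)
    (a v : nat -> nat -> nat -> nat) (old : nat -> nat) (x : nat) : nat -> Prop :=
| Unwritten of (forall i j k, i < W -> j < W -> k < W -> c i j k -> a i j k <> x) :
    grid_scatter_spec c a v old x (old x)
| Written i j k of i < W & j < W & k < W & c i j k & a i j k = x :
    grid_scatter_spec c a v old x (v i j k).

Lemma grid_scatterP (c : nat -> nat -> nat -> bool)
    (a v : nat -> nat -> nat -> nat) old x :
  grid_scatter_spec c a v old x (grid_scatter c a v old x).
Proof.
case: (scatterP P (fun p => c (row p) (col p) (slab p))
         (fun p => a (row p) (col p) (slab p))
         (fun p => v (row p) (col p) (slab p)) old x) => [[nw e]|[p [_ cp ap _ e]]].
  rewrite /grid_scatter e; apply: Unwritten => i j k li lj lk.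
  by have [p [lp <- <- <-]] := grid_pid li lj lk; apply: nw.
by rewrite /grid_scatter e; apply: Written => //; rewrite ltn_mod.
Qed.

Lemma grid_scatter_set (c : nat -> nat -> nat -> bool)
    (a : nat -> nat -> nat -> nat) old x :
  (grid_scatter c a (fun _ _ _ => 1) old x != 0) <->
  (old x != 0 \/ exists i j k, [/\ i < W, j < W, k < W, c i j k & a i j k = x]).
Proof.
case: (grid_scatterP c a (fun _ _ _ => 1) old x) => [nw|i j k li lj lk cc e].
  split=> [|[//|[i [j [k [li lj lk cc e]]]]]]; first by left.
  by case: (nw _ _ _ li lj lk cc e).
by split=> // _; right; exists i, j, k.
Qed.

(** With one cell per row, a priority write finds a least column in a single step. This yields both
    second choices and heights. *)
Lemma grid_scatter_min (c : nat -> nat -> bool) (v : nat -> nat -> nat) old x :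
  x < W ->
  let m := grid_scatter (fun i j _ => c i j) (fun i _ _ => i) (fun i j _ => v i j) old in
  ((forall j, j < W -> c x j = false) /\ m x = old x) \/
  exists j, [/\ j < W, c x j, forall j', j' < j -> c x j' = false & m x = v x j].
Proof.
move=> ltx /=; rewrite /grid_scatter.
have [[nw ->]|[p [lp cp ap minp ->]]] := scatterP P (fun p => c (row p) (col p)) row
  (fun p => v (row p) (col p)) old x.
  left; split=> // j ltj; apply/negP => cx.
  by have [p [lp e1 e2 _]] := grid_pid ltx ltj W_gt0; apply: (nw p lp); rewrite ?e1 ?e2.
right; exists (col p); rewrite -ap ltn_mod W_gt0; split=> // j ltj; apply/negP => cj.
have [q [ltq e1 e2 _]] := grid_shift ltj.
by apply: (minp q ltq); rewrite ?e1 ?e2.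
Qed.

End Grid.

Lemma nth_allpairs (S T R : Type) (f : S -> T -> R) x0 s0 t0 s t i j :
  i < size s -> j < size t ->
  nth x0 [seq f x y | x <- s, y <- t] (i * size t + j) = f (nth s0 s i) (nth t0 t j).
Proof.
move=> + ltj; elim: s i => //= x s ih [|i] lti.
  by rewrite nth_cat size_map ltj (nth_map t0).
by rewrite nth_cat size_map mulSn -addnA ltnNge leq_addr /= addKn ih.
Qed.

(** * The parallel algorithm on arrays *)

(* The literals [2a] and [2a + 1] say that applicant [a] takes its first,
   respectively its second choice. *)
Definition negl (u : nat) : nat := if odd u then u.-1 else u.+1.

Lemma neglK : involutive negl.
Proof. by move=> u; rewrite /negl; case: ifP; case: ifP; lia. Qed.

Lemma odd_negl u : odd (negl u) = ~~ odd u.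
Proof. rewrite /negl; case: ifP; lia. Qed.

Lemma half_negl u : (negl u)./2 = u./2.
Proof. rewrite /negl; case: ifP; lia. Qed.

Lemma negl_lt n u : ~~ odd n -> u < n -> negl u < n.
Proof. rewrite /negl; case: ifP; lia. Qed.

Lemma cell_inj w i j x y : x < w -> y < w -> i * w + x = j * w + y -> i = j /\ x = y.
Proof.
move=> ltx lty e; have w0 : 0 < w by apply: leq_ltn_trans ltx.
have := congr1 (divn^~ w) e; rewrite !divnMDl // !divn_small // !addn0 => ij.
by split=> //; move: e; rewrite ij => /addnI.
Qed.

Lemma ohead_filter (T : Type) (b : pred T) s r p :
  onth s r = Some p -> b p ->
  (forall r' p', r' < r -> onth s r' = Some p' -> ~~ b p') ->
  ohead [seq x <- s | b x] = Some p.
Proof.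
elim: s r => [|x s ih] [|r] //=; first by move=> [->] ->.
move=> e bp h; rewrite (negPf (h 0 x _ _)) //.
by apply: ih e bp _ => r' p' lt; apply: (h r'.+1).
Qed.

Section Algorithm.

Variables (G : instance) (P L : nat).
Notation na := (napp G).
Notation np := (npost G).
Notation app := 'I_na.
Notation post := 'I_np.

Definition half_width : nat := 2 ^ L.
Notation W := half_width.*2.
Notation N := half_width.

Hypothesis size_lt : na + np < N.
Hypothesis P_large : W * W * W <= P.

Notation gs := (grid_scatter P W).

Definition input_rank (i j : nat) : nat :=
  if (i < na) && (j < np) then nth 0 (encode_instance G) (i * np + j).+2 else 0.

(* Posts are stored incremented by one, 0 meaning that there is none. *)
Definition by_rank : nat -> nat :=
  gs (fun i j _ => input_rank i j != 0) (fun i j _ => i * W + input_rank i j)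
     (fun _ j _ => j.+1) (fun=> 0).

Definition first_flag : nat -> nat :=
  gs (fun i j _ => input_rank i j == 1) (fun _ j _ => j) (fun _ _ _ => 1) (fun=> 0).

(** Columns of [by_rank] are ranks, so the least column carries the best post that is not an
    f-post. *)
Definition second : nat -> nat :=
  gs (fun i j _ => [&& i < na, by_rank (i * W + j) != 0 &
                       first_flag (by_rank (i * W + j)).-1 == 0])
     (fun i _ _ => i) (fun i j _ => by_rank (i * W + j)) (fun=> 0).

Definition first (i : nat) : nat := (by_rank (i * W + 1)).-1.

(** [N + i./2] exceeds every post number and belongs to one applicant, so a last resort clashes with
    nobody else. *)
Definition target : nat -> nat :=
  gs (fun i _ _ => i < na.*2) (fun i _ _ => i)
     (fun i _ _ => if odd i then if second i./2 == 0 then N + i./2 else (second i./2).-1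
                   else first i./2) (fun=> 0).

(** An arrow from [i] to [j], because [i] and [negl j] would use the same post. Requiring different
    applicants avoids comparing a literal with itself, which would add an arrow from [i] to
    [negl i]. *)
Definition clash (i j : nat) : bool :=
  [&& i./2 != j./2, i < na.*2, j < na.*2 & target i == target (negl j)].

Fixpoint reach (t : nat) : nat -> nat :=
  match t with
  | 0 => gs (fun i j _ => (i == j) || clash i j) (fun i j _ => i * W + j)
            (fun _ _ _ => 1) (fun=> 0)
  | t.+1 => gs (fun i j k => (reach t (i * W + k) != 0) && (reach t (k * W + j) != 0))
            (fun i j _ => i * W + j) (fun _ _ _ => 1) (reach t)
  end.

Notation R := (reach L.+1).

Definition unsat : nat -> nat :=
  gs (fun _ j _ => (R (j * W + negl j) != 0) && (R (negl j * W + j) != 0))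
     (fun _ _ _ => 0) (fun _ _ _ => 1) (fun=> 0).

(* The processor of least index wins, so this stores the maximum of [W - j]. *)
Definition heights : nat -> nat :=
  gs (fun i j _ => (R (i * W + j) != 0) && (R (negl j * W + j) == 0))
     (fun i _ _ => i) (fun _ j _ => W - j) (fun=> 0).

Definition taken : nat -> nat :=
  gs (fun i _ _ => (i < na) && (heights i.*2 < heights i.*2.+1))
     (fun i _ _ => first i) (fun i _ _ => i.+1) (fun=> 0).

(** The test reads [taken] as it was before the write: posts already taken keep their holder, and
    the write itself picks one of the candidates for a free post. *)
Definition promoted : nat -> nat :=
  gs (fun i _ _ => (i < na) && (taken (first i) == 0))
     (fun i _ _ => first i) (fun i _ _ => i.+1) taken.

Definition output (i : nat) : nat :=
  if promoted (first i) == i.+1 then (first i).+1 else second i.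

(** * Meaning of the arrays *)

Let W_gt0 : 0 < W. Proof. by rewrite double_gt0 expn_gt0. Qed.
Let lt_na (a : app) : a < N.
Proof. apply: leq_ltn_trans size_lt; have := ltn_ord a; lia. Qed.
Let lt_np (p : post) : p < N.
Proof. apply: leq_ltn_trans size_lt; have := ltn_ord p; lia. Qed.
Let lt_naW (a : app) : a < W. Proof. have := lt_na a; lia. Qed.
Let lt_npW (p : post) : p < W. Proof. have := lt_np p; lia. Qed.

Lemma input_rankE (a : app) (p : post) :
  input_rank a p = if p \in pref a then (index p (pref a)).+1 else 0.
Proof.
rewrite /input_rank !ltn_ord /= -[X in a * X](size_enum_ord np).
rewrite (nth_allpairs _ _ a p) ?size_enum_ord ?ltn_ord //.
by rewrite !nth_ord_enum inE.
Qed.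

Lemma input_rank_gt0 i j : input_rank i j != 0 -> exists (a : app) (p : post),
  [/\ i = a, j = p, p \in pref a & input_rank i j = (index p (pref a)).+1].
Proof.
move=> h; have : (i < na) && (j < np) by apply: contraR h; rewrite /input_rank => /negPf ->.
case/andP => lti ltj; exists (Ordinal lti), (Ordinal ltj).
have := input_rankE (Ordinal lti) (Ordinal ltj); rewrite /= => e.
by move: h; rewrite e; case: ifP.
Qed.

Lemma size_pref (a : app) : size (pref a) < N.
Proof.
rewrite -(card_uniqP (pref_uniq a)); apply: leq_ltn_trans (max_card _) _.
by rewrite card_ord; apply: leq_ltn_trans size_lt; rewrite leq_addl.
Qed.

Lemma input_rank_ltW i j : input_rank i j < W.
Proof.
case: (eqVneq (input_rank i j) 0) => [->//|/input_rank_gt0[a [p [_ _ pa ->]]]].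
move: pa; rewrite -index_mem => h; apply: leq_ltn_trans h _.
by apply: leq_trans (size_pref a) _; lia.
Qed.

Lemma by_rankE (a : app) r : r < W ->
  by_rank (a * W + r) = if r is r'.+1 then
     if onth (pref a) r' is Some p then p.+1 else 0 else 0.
Proof.
move=> ltr; rewrite /by_rank; case: (grid_scatterP W_gt0 P_large) =>
  [nw|i j k li lj lk c e].
  case: r ltr nw => // r ltr nw; case e: (onth _ _) => [p|] //.
  have pa : p \in pref a by apply/onthP; exists r.
  have ip : index p (pref a) = r.
    apply: (@onth_inj _ (pref a)); rewrite ?pref_uniq //.
      by rewrite gtn_min index_mem pa orbT.
    by rewrite onthE (nth_map p) ?nth_index ?index_mem.
  by case: (nw a p 0); rewrite ?input_rankE ?pa ?ip.
have [a' [p [ea ep pa er]]] := input_rank_gt0 c.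
have [ei] := cell_inj (input_rank_ltW i j) ltr e; rewrite er => <-.
have -> : a = a' by apply: val_inj; rewrite /= -ei.
by rewrite onthE (nth_map p) ?nth_index ?index_mem ?ep.
Qed.

Lemma firstE (a : app) p : fpost a = Some p -> first a = p.
Proof.
rewrite /first by_rankE; last by have := lt_na a; lia.
by rewrite /fpost; case: (pref a) => //= q s [->].
Qed.

Lemma first_flagE (p : post) : (first_flag p != 0) = is_fpost p.
Proof.
have r1 (a : app) : (input_rank a p == 1) = (fpost a == Some p).
  rewrite input_rankE /fpost; case: (pref a) => //= q s.
  case: (eqVneq q p) => [->|ne]; first by rewrite mem_head !eqxx.
  have -> : (Some q == Some p) = false by apply/eqP => -[e]; rewrite e eqxx in ne.
  by case: ifP.
rewrite /first_flag; apply/idP/existsP.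
  move/(grid_scatter_set W_gt0 P_large) => [//|[i [j [k [li lj lk c e]]]]].
  have [|a [q [ea eq _ _]]] := @input_rank_gt0 i j; first by rewrite (eqP c).
  by exists a; rewrite -r1 -ea -[nat_of_ord p]e.
case=> a ha; apply/(grid_scatter_set W_gt0 P_large); right.
by exists a, p, 0; rewrite r1.
Qed.

Definition oval (o : option post) : nat := if o is Some p then p.+1 else 0.

Lemma secondE (a : app) : second a = oval (spost a).
Proof.
have val_br j (p : post) : j < W -> by_rank (a * W + j) = p.+1 ->
    0 < j /\ onth (pref a) j.-1 = Some p.
  by move=> ltj; rewrite by_rankE //; case: j {ltj} => // j /=;
    case: (onth _ _) => // q [] /val_inj ->.
have br_val j (p : post) : onth (pref a) j = Some p -> by_rank (a * W + j.+1) = p.+1 /\ j.+1 < W.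
  move=> e; have ltj : j.+1 < W.
    have : j < size (pref a) by rewrite -onthTE e.
    by move=> h; apply: leq_ltn_trans h _; apply: leq_trans (size_pref a) _; lia.
  by rewrite by_rankE // e.
have br_ex j : j < W -> by_rank (a * W + j) != 0 -> exists p : post, by_rank (a * W + j) = p.+1.
  move=> ltj; rewrite by_rankE //; case: j {ltj} => // j.
  by case: (onth _ _) => // q _; exists q.
have := grid_scatter_min W_gt0 P_large (fun i j => [&& i < na, by_rank (i * W + j) != 0 &
    first_flag (by_rank (i * W + j)).-1 == 0]) (fun i j => by_rank (i * W + j)) (fun=> 0)
    (lt_naW a).
rewrite -/second => -[[nw ->]|[j [ltj c minj ->]]].
  case e: (spost a) => [p|] //.
  have [/onthP[j ej] nf] := spostP e; have [e1 e2] := br_val _ _ ej.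
  have := nw _ e2; rewrite e1 /= ltn_ord /=.
  by have := first_flagE p; rewrite (negPf nf) => /negbFE ->.
move: c => /and3P[_ c1 c2]; have [p ep] := br_ex j ltj c1.
have [j0 op] := val_br j p ltj ep; rewrite ep /spost.
rewrite (ohead_filter op) //.
  by rewrite -first_flagE; rewrite ep /= in c2; rewrite c2.
(* Ranks count from 1: position [j'] of the list is column [j'.+1]. *)
move=> j' q ltj' /br_val[e1 _].
have := minj j'.+1; rewrite -ltn_predRL => /(_ ltj').
by rewrite e1 /= ltn_ord /= -first_flagE negbK => ->.
Qed.
Definition lit (a : app) (b : bool) : nat := b + (val a).*2.

Lemma half_lit a b : (lit a b)./2 = a. Proof. exact: half_bit_double. Qed.

Lemma odd_lit a b : odd (lit a b) = b. Proof. by rewrite oddD odd_double addbF oddb. Qed.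

Lemma negl_lit a b : negl (lit a b) = lit a (~~ b).
Proof. by rewrite /negl odd_lit /lit; case: b. Qed.

Lemma lit_lt a b : lit a b < na.*2.
Proof. rewrite /lit; have := ltn_ord a; case: b => /=; lia. Qed.

Lemma na2_ltW : na.*2 < W.
Proof. rewrite ltn_double; apply: leq_ltn_trans size_lt; exact: leq_addr. Qed.

Lemma lit_ltW a b : lit a b < W. Proof. exact: ltn_trans (lit_lt a b) na2_ltW. Qed.

Lemma litP u : u < na.*2 -> exists a : app, u = lit a (odd u).
Proof.
move=> ltu; have lth : u./2 < na by rewrite ltn_half_double.
by exists (Ordinal lth); rewrite /lit /= odd_double_half.
Qed.

Definition target_of (a : app) (o : option post) : nat :=
  if o is Some p then p : nat else N + a.

Lemma targetE a b : target (lit a b) = target_of a (if b then spost a else fpost a).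
Proof.
rewrite /target; case: (grid_scatterP W_gt0 P_large) => [nw|i j k li lj lk c e].
  by case: (nw (lit a b) 0 0 (lit_ltW a b) W_gt0 W_gt0 (lit_lt a b)).
rewrite e odd_lit half_lit secondE; case: b e => _; first by case: spost.
by have [p fp _] := fpostP a; rewrite (firstE fp) fp.
Qed.

Lemma target_of_eq a b o o' : target_of a o = target_of b o' ->
  a = b \/ exists2 p, o = Some p & o' = Some p.
Proof.
case: o o' => [p|] [q|] /=; first by move/val_inj->; right; exists q.
- by move=> e; have := lt_np p; rewrite e ltnNge leq_addr.
- by move=> e; have := lt_np q; rewrite -e ltnNge leq_addr.
- by move/addnI/val_inj; left.
Qed.

Let evenW : ~~ odd W. Proof. by rewrite odd_double. Qed.

Definition neg (u : 'I_W) : 'I_W := Ordinal (negl_lt evenW (ltn_ord u)).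

Lemma negK : involutive neg. Proof. by move=> u; apply: val_inj; rewrite /= neglK. Qed.

Definition clash_rel : rel 'I_W := fun u v => clash u v.

Lemma reachE (u v : 'I_W) : (R (u * W + v) != 0) = connect clash_rel u v.
Proof.
apply: (@squaring_connect _ _ (fun t (u v : 'I_W) => reach t (u * W + v) != 0)).
- move=> {}u {}v /=; apply/idP/idP.
    move/(grid_scatter_set W_gt0 P_large) => [//|[i [j [k [li lj lk c e]]]]].
    have [ei ej] := cell_inj lj (ltn_ord v) e; by rewrite ei ej in c.
  move=> h; apply/(grid_scatter_set W_gt0 P_large); right.
  by exists u, v, 0.
- move=> t {}u {}v /=; apply/idP/idP.
    move/(grid_scatter_set W_gt0 P_large) => [->//|[i [j [k [li lj lk c e]]]]].
    have [ei ej] := cell_inj lj (ltn_ord v) e; rewrite ei ej in c.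
    by apply/orP; right; apply/existsP; exists (Ordinal lk).
  move=> h; apply/(grid_scatter_set W_gt0 P_large).
  case/orP: h => [|/existsP[w cw]]; first by left.
  by right; exists u, v, w.
by rewrite card_ord expnS mul2n.
Qed.

Lemma clash_skew (u v : 'I_W) : clash_rel u v -> clash_rel (neg v) (neg u).
Proof.
rewrite /clash_rel /clash /= !half_negl neglK => /and4P[h1 h2 h3 h4].
by rewrite eq_sym h1 !negl_lt ?odd_double // eq_sym.
Qed.

Lemma connect_skew (u v : 'I_W) :
  connect clash_rel u v -> connect clash_rel (neg v) (neg u).
Proof.
case/connectP => p + ->; elim: p u => [|w p ih] u //= /andP[uw /ih h].
exact: connect_trans h (connect1 (clash_skew uw)).
Qed.

Definition weight (u : 'I_W) : nat := W - u.

Lemma weight_inj : injective weight.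
Proof.
move=> u v; rewrite /weight => e; apply: val_inj.
have := ltn_ord u; have := ltn_ord v; rewrite /=; lia.
Qed.

Lemma weight_gt0 u : 0 < weight u. Proof. by rewrite subn_gt0. Qed.

Lemma heightsE (u : 'I_W) : heights u = height neg (connect clash_rel) weight u.
Proof.
have cE (j : 'I_W) : (R (u * W + j) != 0) && (R (negl j * W + j) == 0) =
    connect clash_rel u j && ~~ connect clash_rel (neg j) j.
  by rewrite -!reachE negbK.
have := grid_scatter_min W_gt0 P_large
  (fun i j => (R (i * W + j) != 0) && (R (negl j * W + j) == 0))
  (fun _ j => W - j) (fun=> 0) (ltn_ord u).
rewrite -/heights => -[[nw ->]|[j [ltj c minj ->]]].
  by rewrite /height big_pred0 // => j; rewrite -cE nw.
apply/eqP; rewrite eqn_leq; apply/andP; split.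
  apply: (@leq_bigmax_cond _ _ weight (Ordinal ltj)).
  by rewrite -cE.
apply/bigmax_leqP => i; rewrite -cE => ci; rewrite leq_sub2l // leqNgt.
by apply/negP => /minj; rewrite ci.
Qed.

Lemma unsatE : (unsat 0 != 0) =
  [exists u, connect clash_rel u (neg u) && connect clash_rel (neg u) u].
Proof.
rewrite /unsat; apply/idP/existsP.
  move/(grid_scatter_set W_gt0 P_large) => [//|[i [j [k [li lj lk c e]]]]].
  by exists (Ordinal lj); rewrite -!reachE.
case=> u; rewrite -!reachE => c; apply/(grid_scatter_set W_gt0 P_large); right.
by exists 0, u, 0.
Qed.

(** * A popular matching from a satisfiable instance *)

Section Satisfiable.

Hypothesis no_cycle : forall u : 'I_W,
  ~~ (connect clash_rel u (neg u) && connect clash_rel (neg u) u).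

Definition lit_ord a b : 'I_W := Ordinal (lit_ltW a b).

Definition takes_first (a : app) : bool := heights (lit a false) < heights (lit a true).

Definition holds (u : 'I_W) := sat_val neg (connect clash_rel) weight u.

Lemma takes_firstE a b : holds (lit_ord a b) = b (+) takes_first a.
Proof.
have neg_lit c : neg (lit_ord a c) = lit_ord a (~~ c).
  by apply: val_inj; rewrite /= negl_lit.
have e : holds (lit_ord a false) = takes_first a.
  by rewrite /holds /sat_val -!heightsE neg_lit.
case: b => //=; rewrite -e -[lit_ord a true]/(lit_ord a (~~ false)) -neg_lit.
apply: (sat_val_neg negK (connect0 _) (@connect_trans _ _) connect_skew
          weight_inj weight_gt0 no_cycle).
Qed.

(** For distinct applicants, equal targets give a clash arrow from one literal to the negation of
    the other, so the two cannot both be true. *)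
Lemma no_clash a b c d :
  target (lit a c) = target (lit b d) ->
  c (+) takes_first a -> d (+) takes_first b -> a = b.
Proof.
rewrite -!takes_firstE => e ha hb; apply/eqP; apply: contraT => ab.
have cl : clash_rel (lit_ord a c) (neg (lit_ord b d)).
  rewrite /clash_rel /clash /= neglK e eqxx half_negl !half_lit lit_lt.
  by rewrite negl_lit lit_lt !andbT.
have := sat_val_imp (@connect_trans _ _) connect_skew (connect1 cl) ha.
rewrite (sat_val_neg negK (connect0 _) (@connect_trans _ _) connect_skew
          weight_inj weight_gt0 no_cycle).
by rewrite -/(holds _) hb.
Qed.

Lemma first_inj i p : first i = p -> forall lti : i < na, p < np ->
  exists2 q : post, fpost (Ordinal lti) = Some q & nat_of_ord q = p.
Proof.
move=> e lti ltp; have [q eq _] := fpostP (Ordinal lti).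
by exists q; rewrite // -(firstE eq) -e.
Qed.

Lemma taken_hit a p : takes_first a -> fpost a = Some p -> taken p = a.+1.
Proof.
move=> ta fa; rewrite /taken; case: (grid_scatterP W_gt0 P_large) => [nw|i j k li lj lk].
  by case: (nw a 0 0 (lt_naW a) W_gt0 W_gt0); rewrite ?(firstE fa) // ltn_ord.
case/andP => lti ti e; congr _.+1.
have [q fi /val_inj eqp] := first_inj e lti (ltn_ord p).
suff -> : a = Ordinal lti by [].
by apply: (@no_clash a _ false false); rewrite // !targetE fi fa eqp.
Qed.

Lemma promoted_hit a p : takes_first a -> fpost a = Some p -> promoted p = a.+1.
Proof.
move=> ta fa; rewrite /promoted; case: (grid_scatterP W_gt0 P_large) => [nw|i j k li lj lk].
  exact: taken_hit.
by case/andP => _ /eqP e0 e; rewrite e (taken_hit ta fa) in e0.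
Qed.

Lemma promoted_fpost p : is_fpost p -> exists2 a : app, promoted p = a.+1 & fpost a = Some p.
Proof.
have wr i : i < na -> first i = p -> exists2 a : app, i.+1 = a.+1 & fpost a = Some p.
  move=> lti e; have [q fi /val_inj <-] := first_inj e lti (ltn_ord p).
  by exists (Ordinal lti).
case/existsP => b /eqP fb; rewrite /promoted.
case: (grid_scatterP W_gt0 P_large) => [nw|i j k _ _ _ /andP[lti _]]; last exact: wr.
have := nw b 0 0 (lt_naW b) W_gt0 W_gt0; rewrite (firstE fb) ltn_ord /=.
rewrite /taken; case: (grid_scatterP W_gt0 P_large) => [_ /(_ isT)//|i j k _ _ _].
by case/andP => lti _ e _; apply: wr.
Qed.

Definition assignment (a : app) : option post :=
  if promoted (first a) == a.+1 then fpost a else spost a.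

Lemma output_assignment (a : app) : output a = oval (assignment a).
Proof.
rewrite /output /assignment secondE; case: ifP => // _.
by have [p fp _] := fpostP a; rewrite (firstE fp) fp.
Qed.

(** An applicant whose first-choice literal is true keeps its post in [promoted]. Hence two
    applicants on second choices both have true second-choice literals, and [no_clash] applies
    despite the promotions. First and second choices never coincide, and an entry of [promoted]
    names one applicant. *)
Lemma popular_assignment : popular (graph_of assignment).
Proof.
apply: popular_of_fs.
- split=> [a p|a b p]; rewrite /assignment.
    case: ifP => _; last by case/spostP.
    by have [q -> pq] := fpostP a => -[<-].
  case: (boolP (promoted _ == _)) => [/eqP ha|na_];
    case: (boolP (promoted _ == _)) => [/eqP hb|nb_].
  + move=> fa fb; move: ha hb; rewrite (firstE fa) (firstE fb) => -> [e].
    exact: val_inj.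
  + by move=> /is_fpostP fa /spostP[_]; rewrite fa.
  + by move=> /spostP[_] + /is_fpostP fa; rewrite fa.
  move=> ea eb; have nt (c : app) : promoted (first c) != c.+1 -> ~~ takes_first c.
    by apply: contraNN => tc; have [q fc _] := fpostP c;
      rewrite (firstE fc) (promoted_hit tc fc).
  by apply: (@no_clash a b true true); rewrite /= ?nt // !targetE ea eb.
- by move=> a; rewrite /assignment; case: ifP; [left|right].
move=> p /promoted_fpost[a pa fa]; exists a; split=> //.
by rewrite /assignment (firstE fa) pa eqxx.
Qed.

End Satisfiable.

(** By [popular_fs], a popular matching gives each literal a truth value. As no post is used twice,
    truth passes along clash arrows, hence along paths, and cannot lead from a true literal to its
    negation. *)
Lemma popular_no_cycle (M : {set app * post}) (u : 'I_W) : popular M ->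
  ~~ (connect clash_rel u (neg u) && connect clash_rel (neg u) u).
Proof.
move=> popM; have [mM _] := popM; have [_ inj] := matched_post_acceptable mM.
(* Indices from [na.*2] on are isolated vertices; their value is their parity, so that [truth_neg]
   holds for all of ['I_W]. *)
pose truth (u : 'I_W) := odd u (+) (if insub (u : nat)./2 is Some a
   then matched_post M a == fpost a else false).
have truth_lit (v : 'I_W) a b : nat_of_ord v = lit a b ->
    truth v = b (+) (matched_post M a == fpost a).
  by move=> e; rewrite /truth e odd_lit half_lit valK.
have truth_neg v : truth (neg v) = ~~ truth v.
  by rewrite /truth /= odd_negl half_negl addNb.
have truth_target (v : 'I_W) a b : nat_of_ord v = lit a b -> truth v ->
    target v = target_of a (matched_post M a).
  move=> e; rewrite (truth_lit v a b e) e targetE.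
  by case: b {e} => /=; case: (popular_fs a popM) => ->; rewrite ?eqxx //; move/eqP->.
have truth_clash v w : clash_rel v w -> truth v -> truth w.
  case/and4P => vw /litP[a ea] /litP[b eb] /eqP et tv.
  apply: contraNT vw; rewrite -truth_neg => tw.
  have eb' : nat_of_ord (neg w) = lit b (~~ odd w) by rewrite /= {1}eb negl_lit.
  have := truth_target _ _ _ ea tv; rewrite et (truth_target _ _ _ eb' tw).
  move/target_of_eq => ab; rewrite ea eb !half_lit.
  by case: ab => [->//|[p ep eq]]; rewrite (inj _ _ _ ep eq).
have truth_connect v w : connect clash_rel v w -> truth v -> truth w.
  case/connectP => s + ->; elim: s v => //= x s ih v /andP[vx px] tv.
  exact: ih px (truth_clash _ _ vx tv).
apply/negP => /andP[h1 h2]; have := truth_connect _ _ h1; have := truth_connect _ _ h2.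
by rewrite truth_neg; case: (truth u) => [_ /(_ isT)|/(_ isT)].
Qed.

Lemma output_correct (out : nat -> nat) :
  out 0 = 1 - unsat 0 -> (forall a : app, out a.+1 = output a) ->
  @solves_popular_matching G out.
Proof.
move=> out0 outS; case: (boolP (unsat 0 != 0)) => [h|].
  right; split; first by move: h out0; case: (unsat 0).
  case=> M popM; move: h; rewrite unsatE => /existsP[u].
  by apply/negP; apply: popular_no_cycle popM.
rewrite unsatE negb_exists => /forallP nc.
left; split; last first.
  exists (graph_of assignment); split; first exact: popular_assignment.
  by move=> a; rewrite outS output_assignment // matched_post_graph_of.
have : unsat 0 == 0 by rewrite -[_ == _]negbK unsatE negb_exists; apply/negP/negP/forallP.
by rewrite out0 => /eqP->.
Qed.

End Algorithm.

(** * Arithmetic by loops *)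

Definition bit_length (n : nat) : nat := (0 < n) + trunc_log 2 n.

Lemma bit_lengthP n l : (n < 2 ^ l) = (bit_length n <= l).
Proof.
rewrite /bit_length; case: n => [|n]; first by rewrite trunc_log0 expn_gt0.
apply/idP/idP => h.
  rewrite add1n -(ltn_exp2l _ _ (ltnSn 1)); apply: leq_ltn_trans h.
  exact: trunc_logP.
by apply: leq_trans (trunc_log_ltn n.+1 (ltnSn 1)) _; rewrite leq_exp2l.
Qed.

Lemma half_divn n i : (n %/ 2 ^ i)./2 = n %/ 2 ^ i.+1.
Proof. by rewrite -divn2 -divnMA expnSr. Qed.

Lemma divn_exp_eq0 n i : i <= bit_length n -> (n %/ 2 ^ i == 0) = (i == bit_length n).
Proof.
move=> lei; rewrite -leqn0 leqNgt divn_gt0 ?expn_gt0 // -ltnNge bit_lengthP.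
by rewrite eqn_leq lei.
Qed.

Lemma modn_expS n i : n %% 2 ^ i.+1 = n %% 2 ^ i + odd (n %/ 2 ^ i) * 2 ^ i.
Proof.
have {1}-> : n = (n %/ 2 ^ i)./2 * 2 ^ i.+1 + (n %% 2 ^ i + odd (n %/ 2 ^ i) * 2 ^ i).
  rewrite [LHS](divn_eq n (2 ^ i)) -{1}[n %/ 2 ^ i]odd_double_half -muln2 expnS.
  by set x := odd _; set y := _ ./2; set z := 2 ^ i; set t := n %% z; nia.
rewrite modnMDl modn_small // expnS mul2n -addnn.
have : n %% 2 ^ i < 2 ^ i by rewrite ltn_mod expn_gt0.
by case: odd; lia.
Qed.

Section Macros.

Variables (P K : nat).
Hypothesis K_gt0 : 0 < K.

Notation exec := (@exec P).

Lemma exec_ext K' s sig sig' sig'' : exec K' s sig sig' -> sig'.2 = sig''.2 ->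
  (forall p r, p < P -> sig'.1 p r = sig''.1 p r) -> exec K' s sig sig''.
Proof.
move=> [t lt h] em e; exists t => // pr l cl st hst.
have [st' rst' ast'] := h _ _ cl _ hst; exists st'; first by rewrite -em.
by move=> p ltp; have [-> hr] := ast' p ltp; split=> // r; rewrite hr e.
Qed.

Definition OddE (e : expr) : expr := ESub e (EAdd (EHalf e) (EHalf e)).

Lemma subn_double_half n : n - (n./2 + n./2) = odd n.
Proof. by rewrite addnn -[X in X - _]odd_double_half addnK. Qed.

(** Shift-and-add over the bits of [b], whose value must be common to all processors since it
    controls the loop; that of [a] may vary. Registers 20 and 21 are scratch, above the 20 lasting
    ones. *)
Definition Mul (d a b : nat) : stmt :=
  Seq (Assign 20 (Var a)) (Seq (Assign 21 (Var b)) (Seq (Assign d (Cst 0))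
   (While 21
     (Seq (Assign d (EIf (OddE (Var 21)) (EAdd (Var d) (Var 20)) (Var d)))
     (Seq (Assign 20 (EAdd (Var 20) (Var 20)))
          (Assign 21 (EHalf (Var 21)))))))).

(** Registers are filled in increasing order: each macro extends the known prefix and may spoil what
    lies above it. *)
Definition known (val : nat -> nat -> nat) (n : nat) (g : nat -> nat -> nat) : Prop :=
  forall p r, p < P -> r < n -> g p r = val p r.

Lemma exec_Mul val d a b B g m : d < 20 -> a < d -> b < d -> known val d g ->
  (forall p, p < P -> val p b = B) -> bit_length B < K ->
  (forall p, p < P -> val p d = val p a * B) ->
  exists2 g', exec K (Mul d a b) (g, m) (g', m) & known val d.+1 g'.
Proof.
move=> ltd lta ltb kn hB ltK hd.
(* After [i] rounds the [i] lowest bits of [B] have been consumed. *)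
pose sig i : state :=
  ((fun p => update (update (update (g p) 20 (val p a * 2 ^ i)) 21 (B %/ 2 ^ i))
                    d (val p a * (B %% 2 ^ i))), m).
exists (sig (bit_length B)).1; last first.
  move=> p r ltp; rewrite ltnS leq_eqVlt => /orP[/eqP->|ltr].
    rewrite /= !updateE eqxx modn_small ?hd //.
    by rewrite bit_lengthP.
  by rewrite /= !updateE !ltn_eqF ?kn //; lia.
have d20 : (20 == d) = false by lia.
have d21 : (21 == d) = false by lia.
have e20 : (d == 20) = false by lia.
have e21 : (d == 21) = false by lia.
have loop : exec K (While 21
     (Seq (Assign d (EIf (OddE (Var 21)) (EAdd (Var d) (Var 20)) (Var d)))
     (Seq (Assign 20 (EAdd (Var 20) (Var 20)))
          (Assign 21 (EHalf (Var 21)))))) (sig 0) (sig (bit_length B)).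
  apply: exec_while => // [i p lei ltp|i lti].
    by rewrite /= !updateE d21 eqxx divn_exp_eq0.
  apply: exec_ext (exec_seq (exec_assign _ _ _ _ _ _)
    (exec_seq (exec_assign _ _ _ _ _ _) (exec_assign _ _ _ _ _ _))) _ _ => // p r ltp.
  rewrite /= !updateE !eqxx /= ?d20 ?d21 ?e20 ?e21 /= subn_double_half.
  rewrite half_divn addnn -muln2 -mulnA -expnSr modn_expS.
  case: eqP => [->|]; first by rewrite d21.
  case: eqP => [->|_ _]; first by rewrite d20.
  case: eqP => // _.
  by case: odd => /=; rewrite ?mul1n ?mul0n ?addn0 // mulnDr.
apply: exec_seq (exec_assign _ _ _ _ _ K_gt0) _.
apply: exec_seq (exec_assign _ _ _ _ _ K_gt0) _.
have init : exec K (Assign d (Cst 0))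
    ((fun p => update (update (g p) 20 (eval (Var a) (g p) m)) 21
       (eval (Var b) (update (g p) 20 (eval (Var a) (g p) m)) m)), m) (sig 0).
  apply: exec_ext (exec_assign _ _ _ _ _ _) _ _ => // p r ltp.
  rewrite /= !updateE divn1 modn1 muln0 muln1 (kn p a) // -(hB p ltp) (kn p b) //.
  by have -> : (b == 20) = false by lia.
exact: exec_seq init loop.
Qed.

Definition Shr (d a c : nat) : stmt :=
  Seq (Assign 20 (Var c)) (Seq (Assign d (Var a))
   (While 20 (Seq (Assign d (EHalf (Var d))) (Assign 20 (ESub (Var 20) (Cst 1)))))).

Lemma exec_Shr val d a c C g m : d < 20 -> a < d -> c < d -> known val d g ->
  (forall p, p < P -> val p c = C) -> C < K ->
  (forall p, p < P -> val p d = val p a %/ 2 ^ C) ->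
  exists2 g', exec K (Shr d a c) (g, m) (g', m) & known val d.+1 g'.
Proof.
move=> ltd lta ltc kn hC ltK hd.
pose sig i : state :=
  ((fun p => update (update (g p) 20 (C - i)) d (val p a %/ 2 ^ i)), m).
exists (sig C).1; last first.
  move=> p r ltp; rewrite ltnS leq_eqVlt => /orP[/eqP->|ltr].
    by rewrite /= !updateE eqxx hd.
  by rewrite /= !updateE !ltn_eqF ?kn //; lia.
have d20 : (20 == d) = false by lia.
have e20 : (d == 20) = false by lia.
have loop : exec K (While 20 (Seq (Assign d (EHalf (Var d)))
    (Assign 20 (ESub (Var 20) (Cst 1))))) (sig 0) (sig C).
  apply: exec_while => // [i p lei ltp|i lti].
    by rewrite /= !updateE d20 eqxx; lia.
  apply: exec_ext (exec_seq (exec_assign _ _ _ _ _ _)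
    (exec_assign _ _ _ _ _ _)) _ _ => // p r ltp.
  rewrite /= !updateE !eqxx /= ?d20 ?e20 /= half_divn subn1 -subnS.
  case: eqP => [->|]; first by rewrite d20.
  by case: eqP.
apply: exec_seq (exec_assign _ _ _ _ _ K_gt0) _.
have init : exec K (Assign d (Var a))
    ((fun p => update (g p) 20 (eval (Var c) (g p) m)), m) (sig 0).
  apply: exec_ext (exec_assign _ _ _ _ _ _) _ _ => // p r ltp.
  rewrite /= !updateE divn1 (kn p a) // subn0 -(hC p ltp) (kn p c) //.
  by have -> : (a == 20) = false by lia.
exact: exec_seq init loop.
Qed.

Lemma exec_assign_known val d e g m : known val d g ->
  (forall p, p < P -> eval e (g p) m = val p d) ->
  exists2 g', exec K (Assign d e) (g, m) (g', m) & known val d.+1 g'.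
Proof.
move=> kn he; eexists; first exact: (exec_assign _ _ _ _ _ K_gt0).
move=> p r ltp /=; rewrite updateE ltnS leq_eqVlt => /orP[/eqP->|ltr].
  by rewrite eqxx he.
by rewrite ltn_eqF ?kn.
Qed.

(** Halving [na + np] down to 0 counts its bits. Register 4 starts at 1 because it is to hold the
    logarithm of [W], one more than that of [N]. *)
Definition Width : stmt :=
  Seq (Assign 20 (EAdd (Var 1) (Var 2))) (Seq (Assign 3 (Cst 1)) (Seq (Assign 4 (Cst 1))
   (While 20 (Seq (Assign 20 (EHalf (Var 20)))
     (Seq (Assign 3 (EAdd (Var 3) (Var 3))) (Assign 4 (EAdd (Var 4) (Cst 1)))))))).

Lemma exec_Width val n g m : known val 3 g ->
  (forall p, p < P -> val p 1 + val p 2 = n) -> bit_length n < K ->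
  (forall p, p < P -> val p 3 = 2 ^ bit_length n) ->
  (forall p, p < P -> val p 4 = (bit_length n).+1) ->
  exists2 g', exec K Width (g, m) (g', m) & known val 5 g'.
Proof.
move=> kn hn ltK h3 h4.
pose sig i : state :=
  ((fun p => update (update (update (g p) 20 (n %/ 2 ^ i)) 3 (2 ^ i)) 4 i.+1), m).
exists (sig (bit_length n)).1; last first.
  move=> p r ltp; rewrite /= !updateE.
  case: eqP => [->|n4]; first by rewrite h4.
  case: eqP => [->|n3 ltr]; first by rewrite h3.
  have lt3 : r < 3 by lia.
  by rewrite ltn_eqF ?kn // (ltn_trans lt3).
have loop : exec K (While 20 (Seq (Assign 20 (EHalf (Var 20)))
     (Seq (Assign 3 (EAdd (Var 3) (Var 3))) (Assign 4 (EAdd (Var 4) (Cst 1))))))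
    (sig 0) (sig (bit_length n)).
  apply: exec_while => // [i p lei ltp|i lti].
    by rewrite /= !updateE /= divn_exp_eq0.
  apply: exec_ext (exec_seq (exec_assign _ _ _ _ _ _)
    (exec_seq (exec_assign _ _ _ _ _ _) (exec_assign _ _ _ _ _ _))) _ _ => // p r ltp.
  rewrite /= !updateE /= half_divn addn1 addnn -mul2n -expnS.
  by case: eqP => // _; case: eqP => // _; case: eqP.
apply: exec_seq (exec_assign _ _ _ _ _ K_gt0) _.
apply: exec_seq (exec_assign _ _ _ _ _ K_gt0) _.
have init : exec K (Assign 4 (Cst 1))
    ((fun p => update (update (g p) 20 (eval (EAdd (Var 1) (Var 2)) (g p) m)) 3
       (eval (Cst 1) (update (g p) 20 (eval (EAdd (Var 1) (Var 2)) (g p) m)) m)), m)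
    (sig 0).
  apply: exec_ext (exec_assign _ _ _ _ _ _) _ _ => // p r ltp.
  by rewrite /= !updateE divn1 (kn p 1) // (kn p 2) // hn.
exact: exec_seq init loop.
Qed.

End Macros.

(** * The program *)

(** Writes the processor number in base [W]: quotients by shifts, digits by subtracting back the
    quotient times [W]. Products such as row times [W] are prepared here, so that addresses need
    only additions later. *)
Definition prelude : stmt :=
  Seq (Assign 1 (ERead (Cst 0))) (Seq (Assign 2 (ERead (Cst 1))) (Seq Width
 (Seq (Assign 5 (EAdd (Var 3) (Var 3)))
 (Seq (Shr 6 0 4) (Seq (Shr 7 6 4) (Seq (Shr 8 7 4)
 (Seq (Mul 9 6 5) (Seq (Assign 10 (ESub (Var 0) (Var 9)))
 (Seq (Mul 11 7 5) (Seq (Assign 12 (ESub (Var 6) (Var 11)))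
 (Seq (Mul 13 8 5) (Seq (Assign 14 (ESub (Var 7) (Var 13)))
 (Seq (Mul 15 12 5) (Seq (Mul 16 10 5) (Seq (Mul 17 14 5)
 (Seq (Mul 18 5 5) (Mul 19 12 2))))))))))))))))).

Definition vna := Var 1.
Definition vnp := Var 2.
Definition vN := Var 3.
(** Holds [L.+1], the number of squarings. *)
Definition vL := Var 4.
Definition vW := Var 5.
Definition vj := Var 10.
Definition vi := Var 12.
Definition vk := Var 14.
Definition viW := Var 15.
Definition vjW := Var 16.
Definition vkW := Var 17.
Definition vS := Var 18.
Definition vinp := Var 19.

(** Any nonzero value counts as true, so a truncated difference is a comparison. *)
Definition ELt (a b : expr) : expr := ESub b a.
Definition EAnd (a b : expr) : expr := EIf a b (Cst 0).
Definition EOr (a b : expr) : expr := EIf a (Cst 1) b.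
Definition ENot (a : expr) : expr := ESub (Cst 1) a.
Definition EEq (a b : expr) : expr := EAnd (ENot (ESub a b)) (ENot (ESub b a)).
Definition EPred (a : expr) : expr := ESub a (Cst 1).
Definition ESucc (a : expr) : expr := EAdd a (Cst 1).

(* Array [t] starts at address [t * W ^ 2]; array 0 is the input, and later the
   output. *)
Definition cell (t : nat) (e : expr) : expr := EAdd (iter t (EAdd vS) (Cst 0)) e.
Definition get (t : nat) (e : expr) : expr := ERead (cell t e).

Definition rankX : expr :=
  EIf (EAnd (ELt vi vna) (ELt vj vnp)) (get 0 (ESucc (ESucc (EAdd vinp vj)))) (Cst 0).
Definition byrankX : expr := get 1 (EAdd viW vj).
Definition firstX : expr := EPred (get 1 (ESucc viW)).
Definition neglX : expr := EIf (OddE vj) (EPred vj) (ESucc vj).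
(** [negl j * W], obtained from [j * W] without a multiplication. *)
Definition neglWX : expr := EIf (OddE vj) (ESub vjW vW) (EAdd vjW vW).
Definition naX2 : expr := EAdd vna vna.

Definition closure : stmt :=
  Seq (Assign 20 vL)
   (While 20 (Seq
     (Store (EAnd (get 5 (EAdd viW vk)) (get 5 (EAdd vkW vj))) (cell 5 (EAdd viW vj)) (Cst 1))
     (Assign 20 (EPred (Var 20))))).

Definition main : stmt :=
  Seq prelude
 (Seq (Store rankX (cell 1 (EAdd viW rankX)) (ESucc vj))
 (Seq (Store (EEq rankX (Cst 1)) (cell 2 vj) (Cst 1))
 (Seq (Store (EAnd (ELt vi vna) (EAnd byrankX (ENot (get 2 (EPred byrankX)))))
             (cell 3 vi) byrankX)
 (Seq (Store (ELt vi naX2) (cell 4 vi)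
        (EIf (OddE vi) (EIf (ENot (get 3 (EHalf vi))) (EAdd vN (EHalf vi))
                            (EPred (get 3 (EHalf vi))))
                       (EPred (get 1 (ESucc (EHalf viW))))))
 (Seq (Store (EOr (EEq vi vj) (EAnd (ENot (EEq (EHalf vi) (EHalf vj)))
               (EAnd (ELt vi naX2) (EAnd (ELt vj naX2) (EEq (get 4 vi) (get 4 neglX))))))
             (cell 5 (EAdd viW vj)) (Cst 1))
 (Seq closure
 (Seq (Store (EAnd (get 5 (EAdd vjW neglX)) (get 5 (EAdd neglWX vj)))
             (cell 6 (Cst 0)) (Cst 1))
 (Seq (Store (EAnd (get 5 (EAdd viW vj)) (ENot (get 5 (EAdd neglWX vj))))
             (cell 7 vi) (ESub vW vj))
 (Seq (Store (EAnd (ELt vi vna) (ELt (get 7 (EAdd vi vi)) (get 7 (ESucc (EAdd vi vi)))))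
             (cell 8 firstX) (ESucc vi))
 (Seq (Store (EAnd (ELt vi vna) (ENot (get 8 firstX))) (cell 8 firstX) (ESucc vi))
 (Seq (Store (Cst 1) (cell 0 (Cst 0)) (ESub (Cst 1) (get 6 (Cst 0))))
      (Store (ELt vi vna) (cell 0 (ESucc vi))
         (EIf (EEq (get 8 firstX) (ESucc vi)) (ESucc firstX) (get 3 vi)))))))))))))).

Lemma eval_cell t e g m : eval (cell t e) g m = t * g 18 + eval e g m.
Proof. by congr (_ + _); elim: t => //= t ->. Qed.

Fixpoint bounded_vars (n : nat) (e : expr) : bool :=
  match e with
  | Var r => r < n
  | Cst _ => true
  | EAdd a b | ESub a b => bounded_vars n a && bounded_vars n b
  | EHalf a | ERead a => bounded_vars n a
  | EIf c a b => [&& bounded_vars n c, bounded_vars n a & bounded_vars n b]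
  end.

Lemma eval_bounded n e g g' m : bounded_vars n e ->
  (forall r, r < n -> g r = g' r) -> eval e g m = eval e g' m.
Proof.
move=> be eg; elim: e be => [r|c|a iha b ihb|a iha b ihb|a iha|a iha|c ihc a iha b ihb] //=.
- exact: eg.
- by move=> /andP[/iha-> /ihb->].
- by move=> /andP[/iha-> /ihb->].
- by move=> /iha->.
- by move=> /iha->.
- by move=> /and3P[/ihc-> /iha-> /ihb->].
Qed.

Lemma eval_if c a b g m :
  eval (EIf c a b) g m = if eval c g m != 0 then eval a g m else eval b g m.
Proof. by rewrite /=; case: eqP. Qed.

Lemma eval_lt a b g m : (eval (ELt a b) g m != 0) = (eval a g m < eval b g m).
Proof. by rewrite /= subn_eq0 -ltnNge. Qed.

Lemma eval_not a g m : (eval (ENot a) g m != 0) = (eval a g m == 0).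
Proof. by rewrite /=; case: (eval a g m) => // n; rewrite subSS sub0n. Qed.

Lemma eval_and a b g m :
  (eval (EAnd a b) g m != 0) = (eval a g m != 0) && (eval b g m != 0).
Proof. by rewrite /=; case: (eval a g m). Qed.

Lemma eval_or a b g m :
  (eval (EOr a b) g m != 0) = (eval a g m != 0) || (eval b g m != 0).
Proof. by rewrite /=; case: (eval a g m). Qed.

Lemma eval_eq a b g m : (eval (EEq a b) g m != 0) = (eval a g m == eval b g m).
Proof. by rewrite eval_and !eval_not /= !subn_eq0 -eqn_leq. Qed.

(** Each next state is only known to exist, so the sequence required by [exec_while] is built by
    induction on the number of rounds. *)
Lemma exec_while_inv P K n r s (Inv : nat -> state -> Prop) sig :
  n < K -> Inv 0 sig ->
  (forall i sig p, i <= n -> p < P -> Inv i sig -> (sig.1 p r == 0) = (i == n)) ->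
  (forall i sig, i < n -> Inv i sig ->
     exists2 sig', exec P 1 s sig sig' & Inv i.+1 sig') ->
  exists2 sig', exec P K (While r s) sig sig' & Inv n sig'.
Proof.
move=> ltnK inv0 hr hs.
have [f [f0 fI fx]] : exists f : nat -> state, [/\ f 0 = sig,
    forall i, i <= n -> Inv i (f i) & forall i, i < n -> exec P 1 s (f i) (f i.+1)].
  elim: n {ltnK hr} hs => [|n ih] hs.
    by exists (fun=> sig); split=> // i; rewrite leqn0 => /eqP->.
  have [|f [f0 fI fx]] := ih; first by move=> i sg lti; apply: hs; apply: ltnW.
  have [sg e inv] := hs n (f n) (ltnSn n) (fI n (leqnn n)).
  exists (fun i => if i <= n then f i else sg); split=> // i lei.
    by case: (leqP i n) => [/fI//|lt]; have -> : i = n.+1 by lia.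
  rewrite -ltnS lei; case: (ltnP i n) => [/fx//|le].
  by have -> : i = n by lia.
exists (f n); last exact: fI.
rewrite -f0; apply: exec_while => // i p lei ltp.
exact: hr lei ltp (fI i lei).
Qed.

(** * Simulation of the arrays by the program *)

Section Run.

Variables (G : instance) (P : nat).
Notation na := (napp G).
Notation np := (npost G).

Let L := bit_length (na + np).
Notation N := (half_width L).
Notation W := N.*2.
Notation S := (W * W).

Hypothesis P_large : W * W * W <= P.

Definition regval (p r : nat) : nat :=
  nth 0 [:: p; na; np; N; L.+1; W; p %/ W; p %/ W %/ W; p %/ W %/ W %/ W;
    p %/ W * W; col W p; p %/ W %/ W * W; row W p; p %/ W %/ W %/ W * W; slab W p;
    row W p * W; col W p * W; slab W p * W; S; row W p * np] r.

(** The longest loop multiplies by [W = 2 ^ L.+1], which has [L.+2] bits. *)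
Let K := L.+3.

Let WE : W = 2 ^ L.+1. Proof. by rewrite /half_width expnS mul2n. Qed.

Let size_lt : na + np < N. Proof. by rewrite bit_lengthP. Qed.

Let W_gt0 : 0 < W. Proof. by rewrite double_gt0 expn_gt0. Qed.

Lemma exec_prelude g (m : nat -> nat) : known P regval 1 g -> m 0 = na -> m 1 = np ->
  exists2 g', exec P K prelude (g, m) (g', m) & known P regval 20 g'.
Proof.
move=> k1 m0 m1; rewrite /prelude.
have KW : bit_length W < K by rewrite ltnS -bit_lengthP WE ltn_exp2l.
have ltLK : L < K by rewrite /K; lia.
have seqk n1 n2 s1 s2 g0 :
    (exists2 g', exec P K s1 (g0, m) (g', m) & known P regval n1 g') ->
    (forall g1, known P regval n1 g1 ->
       exists2 g', exec P K s2 (g1, m) (g', m) & known P regval n2 g') ->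
    exists2 g', exec P K (Seq s1 s2) (g0, m) (g', m) & known P regval n2 g'.
  move=> [g1 e1 k] /(_ g1 k)[g2 e2 k2]; exists g2 => //; exact: exec_seq e1 e2.
have shr d a gd : d < 20 -> a < d -> 4 < d -> known P regval d gd ->
    (forall p, regval p d = regval p a %/ W) ->
    exists2 g', exec P K (Shr d a 4) (gd, m) (g', m) & known P regval d.+1 g'.
  move=> ltd lta lt4 kd hd; apply: (exec_Shr _ _ ltd lta lt4 kd (C := L.+1)) => // p ltp.
  by rewrite -WE hd.
have mul d a gd : d < 20 -> a < d -> 5 < d -> known P regval d gd ->
    (forall p, regval p d = regval p a * W) ->
    exists2 g', exec P K (Mul d a 5) (gd, m) (g', m) & known P regval d.+1 g'.
  by move=> ltd lta lt5 kd hd; apply: (exec_Mul _ _ ltd lta lt5 kd (B := W)).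
have asg d e gd : known P regval d gd -> (forall p, p < P -> eval e (gd p) m = regval p d) ->
    exists2 g', exec P K (Assign d e) (gd, m) (g', m) & known P regval d.+1 g'.
  exact: exec_assign_known.
have sub_mod p : p - p %/ W * W = p %% W by rewrite {1}(divn_eq p W) addKn.
apply: (seqk _ _ _ _ _ (asg _ _ _ k1 _)) => [p _|g1 k2]; first by rewrite /= m0.
apply: (seqk _ _ _ _ _ (asg _ _ _ k2 _)) => [p _|g2 k3]; first by rewrite /= m1.
apply: (seqk _ _ _ _ _ (exec_Width _ _ (n := na + np) k3 _ _ _ _)) => // g3 k5.
apply: (seqk _ _ _ _ _ (asg _ _ _ k5 _)) => [p ltp|g4 k6]; first by rewrite /= !k5 //= addnn.
apply: (seqk _ _ _ _ _ (shr _ _ _ _ _ _ k6 _)) => // g5 k7.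
apply: (seqk _ _ _ _ _ (shr _ _ _ _ _ _ k7 _)) => // g6 k8.
apply: (seqk _ _ _ _ _ (shr _ _ _ _ _ _ k8 _)) => // g7 k9.
apply: (seqk _ _ _ _ _ (mul _ _ _ _ _ _ k9 _)) => // g8 k10.
apply: (seqk _ _ _ _ _ (asg _ _ _ k10 _)) => [p ltp|g9 k11].
  by rewrite /= !k10 //= sub_mod.
apply: (seqk _ _ _ _ _ (mul _ _ _ _ _ _ k11 _)) => // g10 k12.
apply: (seqk _ _ _ _ _ (asg _ _ _ k12 _)) => [p ltp|g11 k13].
  by rewrite /= !k12 //= sub_mod.
apply: (seqk _ _ _ _ _ (mul _ _ _ _ _ _ k13 _)) => // g12 k14.
apply: (seqk _ _ _ _ _ (asg _ _ _ k14 _)) => [p ltp|g13 k15].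
  by rewrite /= !k14 //= sub_mod.
apply: (seqk _ _ _ _ _ (mul _ _ _ _ _ _ k15 _)) => // g14 k16.
apply: (seqk _ _ _ _ _ (mul _ _ _ _ _ _ k16 _)) => // g15 k17.
apply: (seqk _ _ _ _ _ (mul _ _ _ _ _ _ k17 _)) => // g16 k18.
have lt5 : 5 < 18 by [].
apply: (seqk _ _ _ _ _ (exec_Mul _ _ (B := W) _ lt5 lt5 k18 _ _ _)) => // g17 k19.
apply: (exec_Mul _ _ (B := np) _ _ _ k19) => //.
have : bit_length np <= L.
  by rewrite -bit_lengthP; apply: leq_ltn_trans size_lt; apply: leq_addl.
by rewrite /K; lia.
Qed.

(** Arrays beyond the end of the list are zero, so the first write to an array appends it to the
    list. *)
Definition holds_arrays (arrs : seq (nat -> nat)) (m : nat -> nat) : Prop :=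
  forall t x, x < S -> m (t * S + x) = nth (fun=> 0) arrs t x.

(** One [Store] amounts to one [grid_scatter]; the bound [S] on offsets keeps the write inside array
    [t]. *)
Lemma exec_store_grid K' arrs arrs' g m t c e v
    (cf : nat -> nat -> nat -> bool) (af vf : nat -> nat -> nat -> nat) :
  0 < K' -> known P regval 20 g -> holds_arrays arrs m ->
  all (bounded_vars 20) [:: c; e; v] ->
  (forall p, (eval c (regval p) m != 0) = cf (row W p) (col W p) (slab W p)) ->
  (forall p, cf (row W p) (col W p) (slab W p) ->
    eval e (regval p) m = af (row W p) (col W p) (slab W p) /\ eval e (regval p) m < S) ->
  (forall p, cf (row W p) (col W p) (slab W p) ->
    eval v (regval p) m = vf (row W p) (col W p) (slab W p)) ->
  set_nth (fun=> 0) arrs t (grid_scatter P W cf af vf (nth (fun=> 0) arrs t)) = arrs' ->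
  exists2 m', exec P K' (Store c (cell t e) v) (g, m) (g, m') & holds_arrays arrs' m'.
Proof.
move=> K_gt0 kn hm /and4P[bc be bv _] hc he hv <-.
eexists; first exact: exec_store K_gt0.
have ev e' p : p < P -> bounded_vars 20 e' -> eval e' (g p) m = eval e' (regval p) m.
  by move=> ltp be'; apply: (eval_bounded _ be') => r ltr; apply: kn.
move=> t' x ltx; rewrite nth_set_nth /=.
rewrite (@eq_scatter _ _ (fun p => cf (row W p) (col W p) (slab W p)) _
  (fun p => t * S + af (row W p) (col W p) (slab W p)) _
  (fun p => vf (row W p) (col W p) (slab W p))); first last.
- by move=> p ltp; rewrite !ev // hc; apply: hv.
- move=> p ltp; rewrite -[_ + _]/(eval (cell t e) (g p) m) eval_cell !ev // hc => cp.
  have [-> _] := he p cp.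
  by rewrite kn.
- by move=> p ltp; rewrite ev // hc.
rewrite scatterE hm //; case: eqP => [->|ne].
  rewrite /grid_scatter scatterE; congr head; congr map; apply: eq_in_filter => p _.
  by rewrite eqn_add2l.
rewrite (@eq_in_filter _ _ pred0) ?filter_pred0 // => p _ /=.
apply/negP => /andP[cp /eqP e']; case: ne; have [ea lt] := he p cp.
by rewrite ea in lt; have [] := cell_inj lt ltx e'.
Qed.

Notation inp := (nth 0 (encode_instance G)).

Let lt_row p : row W p < W. Proof. by rewrite ltn_mod. Qed.
Let lt_col p : col W p < W. Proof. by rewrite ltn_mod. Qed.
Let lt_slab p : slab W p < W. Proof. by rewrite ltn_mod. Qed.

Let W_gt1 : 1 < W.
Proof. by have := W_gt0; case: half_width. Qed.

Let lt_cell i j : i < W -> j < W -> i * W + j < S.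
Proof. by move=> lti ltj; have := W_gt0; nia. Qed.

Let ltW_S x : x <= W -> x < S.
Proof. by move=> lex; have := W_gt1; nia. Qed.

Let half_leq_self n : n./2 <= n. Proof. lia. Qed.

Lemma eval_get arrs m t e p : holds_arrays arrs m -> eval e (regval p) m < S ->
  eval (get t e) (regval p) m = nth (fun=> 0) arrs t (eval e (regval p) m).
Proof.
move=> hm lt; rewrite -hm // -[LHS]/(m (eval (cell t e) (regval p) m)).
by rewrite eval_cell.
Qed.

Lemma eval_naX2 m p : eval naX2 (regval p) m = na.*2.
Proof. by rewrite -addnn. Qed.

Lemma eval_rankX arrs m p : holds_arrays (inp :: arrs) m ->
  eval rankX (regval p) m = input_rank G (row W p) (col W p).
Proof.
move=> hm; rewrite /rankX eval_if eval_and !eval_lt /input_rank.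
rewrite -[eval vi _ _]/(row W p) -[eval vj _ _]/(col W p).
rewrite -[eval vna _ _]/na -[eval vnp _ _]/np; case: ifP => // /andP[li lj].
rewrite (eval_get _ hm) -[eval _ _ _]/(row W p * np + col W p + 1 + 1) !addn1 //.
by have := size_lt; nia.
Qed.

Lemma grid_scatter_le n c a v old x : (forall y, old y <= n) ->
  (forall i j k, i < W -> j < W -> k < W -> v i j k <= n) ->
  grid_scatter P W c a v old x <= n.
Proof. by move=> ho hv; case: (grid_scatterP W_gt0 P_large) => *; auto. Qed.

Lemma by_rank_le x : by_rank G P L x <= W.
Proof. by apply: grid_scatter_le. Qed.

Notation A1 := (by_rank G P L).
Notation A2 := (first_flag G P L).
Notation A3 := (second G P L).
Notation A4 := (target G P L).
Notation A5 := (reach G P L).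
Notation A6 := (unsat G P L).
Notation A7 := (heights G P L).
Notation A8 := (taken G P L).

Lemma eval_byrankX arrs m p : holds_arrays [:: inp, A1 & arrs] m ->
  eval byrankX (regval p) m = A1 (row W p * W + col W p).
Proof.
by move=> hm; rewrite (eval_get _ hm) -[eval _ _ _]/(row W p * W + col W p) ?lt_cell.
Qed.

Lemma eval_firstX a0 arrs m p : holds_arrays [:: a0, A1 & arrs] m ->
  eval firstX (regval p) m = first G P L (row W p).
Proof.
move=> hm; rewrite -[LHS]/(eval (get 1 (ESucc viW)) (regval p) m - 1) subn1.
by rewrite (eval_get _ hm) -[eval _ _ _]/(row W p * W + 1) ?lt_cell.
Qed.

Lemma eval_neglX m p : eval neglX (regval p) m = negl (col W p).
Proof.
rewrite /neglX eval_if -[eval _ _ _]/(col W p - ((col W p)./2 + (col W p)./2)).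
rewrite -[eval (EPred _) _ _]/(col W p - 1) -[eval (ESucc _) _ _]/(col W p + 1).
by rewrite subn_double_half eqb0 negbK subn1 addn1.
Qed.

Lemma eval_neglWX m p : eval neglWX (regval p) m = negl (col W p) * W.
Proof.
rewrite /neglWX eval_if -[eval _ _ _]/(col W p - ((col W p)./2 + (col W p)./2)).
rewrite -[eval (ESub _ _) _ _]/(col W p * W - W) -[eval (EAdd _ _) _ _]/(col W p * W + W).
rewrite subn_double_half eqb0 negbK /negl; case: ifP => _; last by rewrite mulSn addnC.
by rewrite -subn1 mulnBl mul1n.
Qed.

Let negl_ltW j : j < W -> negl j < W.
Proof. by apply: negl_lt; rewrite odd_double. Qed.

Lemma exec_main_arrays g m : known P regval 1 g -> holds_arrays [:: inp] m ->
  exists g' m', exec P K main (g, m) (g', m') /\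
    (m' 0 = 1 - A6 0 /\ forall a : 'I_na, m' a.+1 = output G P L a).
Proof.
move=> kg0 hm0.
have m00 : m 0 = na by have := hm0 0 0; rewrite muln_gt0 W_gt0 => ->.
have m01 : m 1 = np by have := hm0 0 1; rewrite mul0n => -> //; apply: ltW_S.
have [g0 eg0 kn] := exec_prelude kg0 m00 m01.
have [m1 e1 hm1] : exists2 m', exec P K (Store rankX (cell 1 (EAdd viW rankX)) (ESucc vj))
   (g0, m) (g0, m') & holds_arrays [:: inp; A1] m'.
  apply: (exec_store_grid
    (cf := fun i j _ => input_rank G i j != 0)
    (af := fun i j _ => i * W + input_rank G i j) (vf := fun _ j _ => j.+1) _ kn hm0) => //.
  - by move=> p; rewrite (eval_rankX _ hm0).
  - move=> p; rewrite -[eval (EAdd _ _) _ _]/(row W p * W + eval rankX (regval p) m).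
    rewrite (eval_rankX _ hm0) => _; split=> //; apply: lt_cell => //.
    exact: input_rank_ltW.
  - by move=> p _; rewrite -addn1.
have [m2 e2 hm2] : exists2 m', exec P K (Store (EEq rankX (Cst 1)) (cell 2 vj) (Cst 1))
   (g0, m1) (g0, m') & holds_arrays [:: inp; A1; A2] m'.
  apply: (exec_store_grid
    (cf := fun i j _ => input_rank G i j == 1)
    (af := fun i j _ => j) (vf := fun _ _ _ => 1) _ kn hm1) => //.
  - by move=> p; rewrite eval_eq (eval_rankX _ hm1).
  - by move=> p; rewrite ltW_S //; apply/ltnW/lt_col.
have [m3 e3 hm3] : exists2 m', exec P K
    (Store (EAnd (ELt vi vna) (EAnd byrankX (ENot (get 2 (EPred byrankX)))))
             (cell 3 vi) byrankX) (g0, m2) (g0, m') & holds_arrays [:: inp; A1; A2; A3] m'.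
  apply: (exec_store_grid
    (cf := fun i j _ => [&& i < na, A1 (i * W + j) != 0 & A2 (A1 (i * W + j)).-1 == 0])
    (af := fun i j _ => i) (vf := fun i j _ => A1 (i * W + j)) _ kn hm2) => //.
  - move=> p; rewrite !eval_and eval_lt eval_not (eval_byrankX _ hm2) (eval_get _ hm2).
      by rewrite -[eval (EPred _) _ _]/(eval byrankX (regval p) m2 - 1) (eval_byrankX _ hm2) subn1.
    rewrite -[eval (EPred _) _ _]/(eval byrankX (regval p) m2 - 1) (eval_byrankX _ hm2).
    by apply: ltW_S; rewrite (leq_trans (leq_subr _ _)) // by_rank_le.
  - by move=> p; rewrite ltW_S //; apply/ltnW/lt_row.
  - by move=> p _; rewrite (eval_byrankX _ hm2).
have [m4 e4 hm4] : exists2 m', exec P K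
    (Store (ELt vi naX2) (cell 4 vi)
        (EIf (OddE vi) (EIf (ENot (get 3 (EHalf vi))) (EAdd vN (EHalf vi))
                            (EPred (get 3 (EHalf vi))))
                       (EPred (get 1 (ESucc (EHalf viW))))))
    (g0, m3) (g0, m') & holds_arrays [:: inp; A1; A2; A3; A4] m'.
  apply: (exec_store_grid
    (cf := fun i _ _ => i < na.*2) (af := fun i _ _ => i)
    (vf := fun i _ _ => if odd i then if A3 i./2 == 0 then N + i./2 else (A3 i./2).-1
                        else first G P L i./2) _ kn hm3) => //.
  - by move=> p; rewrite eval_lt eval_naX2.
  - by move=> p; rewrite ltW_S //; apply/ltnW/lt_row.
  move=> p _; rewrite eval_if -[eval (OddE _) _ _]/(row W p - ((row W p)./2 + (row W p)./2)).
  rewrite subn_double_half eqb0 negbK.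
  have lth : (row W p)./2 < S.
    by apply: ltW_S; rewrite leq_half_double; have := lt_row p; lia.
  case: ifP => [_|odd_p].
    rewrite eval_if eval_not -[eval (EAdd _ _) _ _]/(N + (row W p)./2).
    rewrite -[eval (EPred _) _ _]/(eval (get 3 (EHalf vi)) (regval p) m3 - 1) subn1.
    by rewrite (eval_get _ hm3).
  (* This needs an even row; for odd rows the select discards the value read. *)
  have e : (row W p * W)./2 = (row W p)./2 * W.
    by rewrite -[X in X * W]odd_double_half odd_p add0n -!muln2 mulnAC muln2 doubleK.
  have ea : eval (ESucc (EHalf viW)) (regval p) m3 = (row W p)./2 * W + 1 by rewrite -e.
  rewrite -[LHS]/(eval (get 1 (ESucc (EHalf viW))) (regval p) m3 - 1) subn1.
  rewrite (eval_get _ hm3) ea // lt_cell //.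
  by apply: leq_ltn_trans (lt_row p); apply: half_leq_self.
have [m5 e5 hm5] : exists2 m', exec P K
    (Store (EOr (EEq vi vj) (EAnd (ENot (EEq (EHalf vi) (EHalf vj)))
               (EAnd (ELt vi naX2) (EAnd (ELt vj naX2) (EEq (get 4 vi) (get 4 neglX))))))
             (cell 5 (EAdd viW vj)) (Cst 1))
    (g0, m4) (g0, m') & holds_arrays [:: inp; A1; A2; A3; A4; A5 0] m'.
  apply: (exec_store_grid
    (cf := fun i j _ => (i == j) || clash G P L i j)
    (af := fun i j _ => i * W + j) (vf := fun _ _ _ => 1) _ kn hm4) => //.
  - move=> p; rewrite eval_or eval_eq eval_and eval_not -[eval (EEq _ _) _ _ == 0]negbK eval_eq.
    rewrite eval_and eval_lt eval_and eval_lt eval_eq !(eval_get _ hm4) ?eval_neglX.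
    + by rewrite eval_naX2 /clash.
    + by apply/ltW_S/ltnW/negl_ltW/lt_col.
    + by apply/ltW_S/ltnW/lt_row.
  - by move=> p; rewrite -[eval _ _ _]/(row W p * W + col W p) lt_cell.
have [[g6 m6] e6 [_ kn6 hm6]] : exists2 sig', exec P K closure (g0, m5) sig' &
    [/\ forall p, p < P -> sig'.1 p 20 = 0, known P regval 20 sig'.1 &
     holds_arrays [:: inp; A1; A2; A3; A4; A5 L.+1] sig'.2].
  pose Inv i (sig : state) := [/\ forall p, p < P -> sig.1 p 20 = L.+1 - i,
    known P regval 20 sig.1 & holds_arrays [:: inp; A1; A2; A3; A4; A5 i] sig.2].
  have ea : exec P K (Assign 20 vL) (g0, m5)
      (fun p => update (g0 p) 20 (eval vL (g0 p) m5), m5) by apply: exec_assign.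
  suff [sig' ew [w1 w2 w3]] : exists2 sig',
     exec P K (While 20 (Seq
       (Store (EAnd (get 5 (EAdd viW vk)) (get 5 (EAdd vkW vj))) (cell 5 (EAdd viW vj)) (Cst 1))
       (Assign 20 (EPred (Var 20)))))
     (fun p => update (g0 p) 20 (eval vL (g0 p) m5), m5) sig' & Inv L.+1 sig'.
    exists sig'; first exact: exec_seq ea ew.
    by split=> // p ltp; rewrite w1 // subnn.
  apply: exec_while_inv => //.
  - split=> //= [p ltp|p r ltp ltr]; rewrite updateE; first by rewrite eqxx kn // subn0.
    by rewrite ltn_eqF // kn.
  - move=> i sig p lei ltp [-> // _ _]; lia.
  move=> i [g' m'] lti [/= w1 w2 w3].
  have [m'' e'' hm''] : exists2 m'', exec P 1
      (Store (EAnd (get 5 (EAdd viW vk)) (get 5 (EAdd vkW vj))) (cell 5 (EAdd viW vj)) (Cst 1))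
      (g', m') (g', m'') & holds_arrays [:: inp; A1; A2; A3; A4; A5 i.+1] m''.
    apply: (exec_store_grid
      (cf := fun x y z => (A5 i (x * W + z) != 0) && (A5 i (z * W + y) != 0))
      (af := fun x y _ => x * W + y) (vf := fun _ _ _ => 1) _ w2 w3) => //.
    - move=> p; rewrite eval_and !(eval_get _ w3) //.
      + by rewrite -[eval _ _ _]/(slab W p * W + col W p) lt_cell.
      + by rewrite -[eval _ _ _]/(row W p * W + slab W p) lt_cell.
    - by move=> p; rewrite -[eval _ _ _]/(row W p * W + col W p) lt_cell.
  eexists; first exact: exec_seq e'' (exec_assign _ _ _ _ _ _).
  split=> //= [p ltp|p r ltp ltr]; rewrite updateE; first by rewrite eqxx w1 //; lia.
  by rewrite ltn_eqF // w2.
have [m7 e7 hm7] : exists2 m', exec P K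
    (Store (EAnd (get 5 (EAdd vjW neglX)) (get 5 (EAdd neglWX vj)))
             (cell 6 (Cst 0)) (Cst 1))
    (g6, m6) (g6, m') & holds_arrays [:: inp; A1; A2; A3; A4; A5 L.+1; A6] m'.
  have e1' p : eval (EAdd vjW neglX) (regval p) m6 = col W p * W + negl (col W p).
    by rewrite -(eval_neglX m6).
  have e2' p : eval (EAdd neglWX vj) (regval p) m6 = negl (col W p) * W + col W p.
    by rewrite -(eval_neglWX m6).
  apply: (exec_store_grid
    (cf := fun _ j _ => (A5 L.+1 (j * W + negl j) != 0) && (A5 L.+1 (negl j * W + j) != 0))
    (af := fun _ _ _ => 0) (vf := fun _ _ _ => 1) _ kn6 hm6) => //.
  - move=> p; rewrite eval_and !(eval_get _ hm6) ?e1' ?e2' //.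
    + by apply: lt_cell => //; apply: negl_ltW.
    + by apply: lt_cell => //; apply: negl_ltW.
  - by move=> p; rewrite muln_gt0 W_gt0.
have [m8 e8 hm8] : exists2 m', exec P K
    (Store (EAnd (get 5 (EAdd viW vj)) (ENot (get 5 (EAdd neglWX vj))))
             (cell 7 vi) (ESub vW vj))
    (g6, m7) (g6, m') & holds_arrays [:: inp; A1; A2; A3; A4; A5 L.+1; A6; A7] m'.
  have e2' p : eval (EAdd neglWX vj) (regval p) m7 = negl (col W p) * W + col W p.
    by rewrite -(eval_neglWX m7).
  apply: (exec_store_grid
    (cf := fun i j _ => (A5 L.+1 (i * W + j) != 0) && (A5 L.+1 (negl j * W + j) == 0))
    (af := fun i _ _ => i) (vf := fun _ j _ => W - j) _ kn6 hm7) => //.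
  - move=> p; rewrite eval_and eval_not !(eval_get _ hm7) ?e2' //.
    + by apply: lt_cell => //; apply: negl_ltW.
    + by rewrite -[eval _ _ _]/(row W p * W + col W p) lt_cell.
  - by move=> p; rewrite ltW_S //; apply/ltnW/lt_row.
have [m9 e9 hm9] : exists2 m', exec P K
    (Store (EAnd (ELt vi vna) (ELt (get 7 (EAdd vi vi)) (get 7 (ESucc (EAdd vi vi)))))
             (cell 8 firstX) (ESucc vi))
    (g6, m8) (g6, m') & holds_arrays [:: inp; A1; A2; A3; A4; A5 L.+1; A6; A7; A8] m'.
  have lt2 i : i < W -> i.*2.+1 < S by have := W_gt1; nia.
  apply: (exec_store_grid
    (cf := fun i _ _ => (i < na) && (A7 i.*2 < A7 i.*2.+1))
    (af := fun i _ _ => first G P L i) (vf := fun i _ _ => i.+1) _ kn6 hm8) => //.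
  - move=> p; rewrite eval_and eval_lt eval_lt.
    have e1' : eval (EAdd vi vi) (regval p) m8 = (row W p).*2 by rewrite -[RHS]addnn.
    have e2' : eval (ESucc (EAdd vi vi)) (regval p) m8 = (row W p).*2.+1.
      by rewrite -[RHS]addn1 -[in RHS]addnn.
    by rewrite !(eval_get _ hm8) ?e1' ?e2' ?lt2 // ltnW // lt2.
  - move=> p _; rewrite (eval_firstX _ hm8); split=> //.
    by apply: ltW_S; apply: leq_trans (leq_pred _) (by_rank_le _).
  - by move=> p _; rewrite -addn1.
have lt_first i : first G P L i < S.
  by apply: ltW_S; apply: leq_trans (leq_pred _) (by_rank_le _).
have [m10 e10 hm10] : exists2 m', exec P K
    (Store (EAnd (ELt vi vna) (ENot (get 8 firstX))) (cell 8 firstX) (ESucc vi))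
    (g6, m9) (g6, m') &
    holds_arrays [:: inp; A1; A2; A3; A4; A5 L.+1; A6; A7; promoted G P L] m'.
  apply: (exec_store_grid
    (cf := fun i _ _ => (i < na) && (A8 (first G P L i) == 0))
    (af := fun i _ _ => first G P L i) (vf := fun i _ _ => i.+1) _ kn6 hm9) => //.
  - move=> p; rewrite eval_and eval_lt eval_not (eval_get _ hm9) (eval_firstX _ hm9) //.
  - by move=> p _; rewrite (eval_firstX _ hm9).
  - by move=> p _; rewrite -addn1.
pose out0 := grid_scatter P W (fun _ _ _ => true) (fun _ _ _ => 0) (fun _ _ _ => 1 - A6 0) inp.
have [m11 e11 hm11] : exists2 m', exec P K
    (Store (Cst 1) (cell 0 (Cst 0)) (ESub (Cst 1) (get 6 (Cst 0))))
    (g6, m10) (g6, m') &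
    holds_arrays [:: out0; A1; A2; A3; A4; A5 L.+1; A6; A7; promoted G P L] m'.
  apply: (exec_store_grid
    (cf := fun _ _ _ => true) (af := fun _ _ _ => 0) (vf := fun _ _ _ => 1 - A6 0)
    _ kn6 hm10) => //.
  - by move=> p _; rewrite muln_gt0 W_gt0.
  - move=> p _; rewrite -[LHS]/(1 - eval (get 6 (Cst 0)) (regval p) m10).
    by rewrite (eval_get _ hm10) // muln_gt0 W_gt0.
have [m12 e12 hm12] : exists2 m', exec P K
    (Store (ELt vi vna) (cell 0 (ESucc vi))
         (EIf (EEq (get 8 firstX) (ESucc vi)) (ESucc firstX) (get 3 vi)))
    (g6, m11) (g6, m') &
    holds_arrays [:: grid_scatter P W (fun i _ _ => i < na) (fun i _ _ => i.+1)
       (fun i _ _ => output G P L i) out0;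
      A1; A2; A3; A4; A5 L.+1; A6; A7; promoted G P L] m'.
  apply: (exec_store_grid
    (cf := fun i _ _ => i < na) (af := fun i _ _ => i.+1)
    (vf := fun i _ _ => output G P L i) _ kn6 hm11) => //.
  - by move=> p; rewrite eval_lt.
  - by move=> p _; rewrite -[eval _ _ _]/(row W p + 1) addn1 ltW_S.
  - move=> p _; rewrite eval_if eval_eq.
    rewrite -[eval (ESucc firstX) _ _]/(eval firstX (regval p) m11 + 1).
    have lt1 : eval firstX (regval p) m11 < S by rewrite (eval_firstX _ hm11).
    have lt2 : eval vi (regval p) m11 < S by apply/ltW_S/ltnW/lt_row.
    rewrite (eval_get _ hm11 lt1) (eval_get _ hm11 lt2) (eval_firstX _ hm11).
    by rewrite -[eval (ESucc vi) _ _]/(row W p + 1) !addn1.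
exists g6, m12; split.
  do 11! [apply: exec_seq; first eassumption].
  exact: exec_seq e11 e12.
split.
  have := hm12 0 0; rewrite muln_gt0 W_gt0 => -> //=.
  (* The last write only addresses cells [i.+1], so the verdict in cell 0 survives it. *)
  case: (grid_scatterP W_gt0 P_large) => [_|//].
  rewrite /out0; case: (grid_scatterP W_gt0 P_large) => [nw|//].
  by case: (nw 0 0 0).
move=> a; have lta : a < W.
  by have := ltn_ord a; have := size_lt; lia.
have := hm12 0 a.+1; rewrite ltW_S // => -> //=.
case: (grid_scatterP W_gt0 P_large) => [nw|i j k _ _ _ _ [->]//].
by case: (nw a 0 0).
Qed.

End Run.

(** * Processor and time bounds *)

Lemma width_bound n (W := (half_width (bit_length n)).*2) : W * W * W <= n ^ 64 + 64.
Proof.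
have [n0|n0] := posnP n; first by rewrite /W n0 exp0n.
have leW : W <= 4 * n.
  rewrite /W /half_width /bit_length n0 add1n expnS.
  by have := trunc_logP (ltnSn 1) n0; lia.
(* For [n = 1] the width is 4, and the additive constant absorbs its cube 64. *)
have [n1|n1] := eqVneq n 1; first by rewrite /W n1 exp1n.
have le1 : W * W * W <= 2 ^ 6 * n ^ 3.
  apply: leq_trans (leq_mul (leq_mul leW leW) leW) _.
  by rewrite mulnn -expnSr expnMn.
apply: leq_trans le1 _; apply: leq_trans (leq_addr _ _).
have n2 : 2 <= n by rewrite ltn_neqAle eq_sym n1.
(* From [n = 2] on, the factor [2 ^ 6] is at most [n ^ 6]. *)
apply: (@leq_trans (n ^ 6 * n ^ 3)); first by rewrite leq_mul2r leq_exp2r // n2 orbT.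
by rewrite -expnD leq_pexp2l.
Qed.

(** The input takes [2 + na * np] cells, at most [S], so it fits in array 0. *)
Lemma init_arrays G m (S := let W := (half_width (bit_length (napp G + npost G))).*2 in W * W) :
  m = nth 0 (encode_instance G) ->
  forall t x, x < S -> m (t * S + x) = nth (fun=> 0) [:: nth 0 (encode_instance G)] t x.
Proof.
pose L := bit_length (napp G + npost G).
have ltN : napp G + npost G < 2 ^ L by rewrite bit_lengthP.
have le_size : size (encode_instance G) <= S.
  rewrite /= size_allpairs !size_enum_ord /S /half_width -/L; nia.
move=> -> [|t] x ltx; first by [].
rewrite nth_default ?nth_nil; first by case: t.
by apply: leq_trans le_size _; rewrite mulSn -addnA leq_addr.
Qed.

Lemma exec_run P K s (input : seq nat) m' (g0 := fun p r => update (fun=> 0) 0 p r.*2) g' :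
  exec P K s (g0, nth 0 input) (g', m') ->
  exists t, [/\ t <= K * round_time s,
    halted (compile 0 s) (run (compile 0 s) t (init P input)) &
    shared (run (compile 0 s) t (init P input)) = m'].
Proof.
case=> t let_ ht; pose st p := Proc 0 (update (fun=> 0) 0 p).
have hcode : code_at (compile 0 s) 0 (compile 0 s) by exists [::], [::]; rewrite cats0.
have hst : at_line P 0 g0 st by [].
have [st' rst ast] := ht _ 0 hcode st hst.
have r : run (compile 0 s) t (init P input) = conf P st' m' by [].
exists t; rewrite r; split=> //; rewrite /halted /= all_map.
apply/allP => p; rewrite mem_iota => /andP[_ ltp].
(* All processors end just past the program, where [fetch] returns [Halt]. *)
by have [e _] := ast p ltp; rewrite /= /proc_halted /fetch e nth_default.
Qed.

Theorem theorem2 :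
  solvable_in_NC instance_size encode_instance solves_popular_matching.
Proof.
(* The time is at most [L + 3] times [round_time main], and [L] is at most the logarithm plus 1;
   this gives the factor 4 and the exponent 1. *)
exists (compile 0 main), 64, (4 * round_time main), 1 => G.
have PW := width_bound (instance_size G).
have kn P : known P (regval G) 1 (fun p r => update (fun=> 0) 0 p r.*2) by move=> p [|//].
have [g' [m' [ex [out0 outS]]]] := exec_main_arrays PW (kn _) (@init_arrays G _ erefl).
have [t [let_ ht sh]] := exec_run ex; exists t; split=> //; last first.
  rewrite sh; apply: (output_correct _ PW) => //.
  by rewrite bit_lengthP.
apply: leq_trans let_ _; move: (round_time main) => T.
rewrite expn1 /bit_length -/(instance_size G).
by case: (0 < instance_size G); lia.
Qed.
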